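(* Let $X$ be a curve whose function field $F$ is a cyclic extension of degree $p^n$ of the rational function field $k(x)$ with only one ramified place, which is totally ramified; let $P_{i_0}$ be the corresponding point of $X$. Then the biggest gap at $P_{i_0}$ is equal to $$(\Gamma_0-2)p^n+\rho^{(0)}+1=\delta-2p^n+1,$$ and the Weierstrass semigroup at $P_{i_0}$ is symmetric.
   Context: The constant field (also denoted $k$) is algebraically closed of characteristic $p>0$, and $X$ is a projective nonsingular curve of genus $g\ge 2$. $\delta$ is the different exponent of $P_{i_0}$ in $F/k(x)$, $\Gamma_0=\lfloor \delta/p^n\rfloor$ is the Boseck invariant with index $0$ (there being one ramified place), and $\rho^{(0)}=\delta-p^n\Gamma_0$ is the remainder of the division of $\delta$ by $p^n$. The Weierstrass semigroup at a point $P$ is the set of integers $a\ge0$ such that some function on $X$ has pole divisor $aP$; the gaps are the positive integers not in it (there are $g$ of them). A semigroup with $g$ gaps is called symmetric if its $g$-th (largest) gap is $2g-1$. *)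

(* Defs.v *)
From HB Require Import structures.
From mathcomp Require Import all_boot all_order all_fingroup all_algebra.
From mathcomp Require Import all_solvable all_field.
From mathcomp Require Import boolp.
From mathcomp Require Import freeg.

Set Implicit Arguments.
Unset Strict Implicit.
Unset Printing Implicit Defensive.

Import Order.TTheory GRing.Theory Num.Theory.
Local Open Scope ring_scope.

(* A place of E/k is given by its normalized discrete valuation, trivial on the
   constants iota(k).  Valuations take values in int: the value at 0, which
   should be +oo, is the dummy 0, so that 0 <= v z cuts out the valuation ring
   (but 0 < v z cuts out the maximal ideal minus 0). *)
Record place (k E : fieldType) (iota : {rmorphism k -> E}) := Place {
  pval :> E -> int;
  pval0 : pval 0 = 0;
  pvalM : forall y z, y != 0 -> z != 0 -> pval (y * z) = pval y + pval z;
  pvalD : forall y z, y != 0 -> z != 0 -> y + z != 0 ->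
    Num.min (pval y) (pval z) <= pval (y + z);
  pvalC : forall c : k, pval (iota c) = 0;
  pval_surj : exists2 t : E, t != 0 & pval t = 1
}.

(* Classical: only needed so that divisors can be taken in {freeg point / int}. *)
HB.instance Definition _ (k E : fieldType) (iota : {rmorphism k -> E}) :=
  gen_eqMixin (place iota).
HB.instance Definition _ (k E : fieldType) (iota : {rmorphism k -> E}) :=
  gen_choiceMixin (place iota).

Definition valuation_ring (k E : fieldType) (iota : {rmorphism k -> E})
    (P : place iota) : pred E := fun z => 0 <= P z.

Notation ratfun k := {fraction {poly k}}.

Definition ratfun_const (k : fieldType) : {rmorphism k -> ratfun k} :=
  @tofrac _ \o polyC.

Section FunctionField.

Variables (k : fieldType) (F : splittingFieldType (ratfun k)).

Definition ff_const : {rmorphism k -> F} := in_alg F \o ratfun_const k.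

(* The points of the projective nonsingular curve with function field F. *)
Definition point := place ff_const.

(* k being algebraically closed, every point has degree 1, so the degree of a
   divisor is the sum [deg] of its coefficients. *)
Definition divisor := {freeg point / int}.

Implicit Types (P : point) (D : divisor).

Definition has_pole_divisor (f : F) D : Prop :=
  f != 0 /\ forall P, coeff P D = Num.max 0 (- P f).

Definition RRspace D (f : F) : Prop :=
  f = 0 \/ forall P, - coeff P D <= P f.

Definition RRdim D (m : nat) : Prop :=
  exists b : 'I_m -> F,
    [/\ forall i, RRspace D (b i),
        forall c : 'I_m -> k, \sum_i ff_const (c i) * b i = 0 ->
          forall i, c i = 0
      & forall f, RRspace D f ->
          exists c : 'I_m -> k, f = \sum_i ff_const (c i) * b i].

(* g = max_D (deg D - l(D) + 1). *)
Definition genus (g : nat) : Prop :=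
  (forall D m, RRdim D m -> deg D - m%:Z + 1 <= g%:Z) /\
  (exists D m, RRdim D m /\ deg D - m%:Z + 1 = g%:Z).

Definition ramification_index P (Q : place (ratfun_const k)) (e : nat) : Prop :=
  (0 < e)%N /\ forall a : ratfun k, P (a%:A) = e%:Z * Q a.

(* k being algebraically closed, residue fields are all k, so that there is no
   inseparable residue extension to take into account. *)
Definition ramified P : Prop :=
  exists Q e, ramification_index P Q e /\ (1 < e)%N.

Definition totally_ramified P : Prop :=
  exists Q, ramification_index P Q (\dim {:F}).

Definition integral_closure (Q : place (ratfun_const k)) (z : F) : Prop :=
  exists p : {poly ratfun k},
    [/\ p \is monic, forall i, valuation_ring Q p`_i
      & root (map_poly (in_alg F) p) z].

(* Meaningful when F is Galois over k(x), galTrace being then its trace. *)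
Definition complementary_module (Q : place (ratfun_const k)) (z : F) : Prop :=
  forall w, integral_closure Q w ->
    exists2 a, valuation_ring Q a & galTrace 1%AS {:F}%AS (z * w) = a%:A.

(* If t generates the complementary module at the place Q below P over the
   integral closure of O_Q, the different exponent at P is - v_P(t). *)
Definition different_exponent P (delta : nat) : Prop :=
  exists Q e, ramification_index P Q e /\
  exists t : F, [/\ t != 0,
    forall z, complementary_module Q z <->
      (exists2 w, integral_closure Q w & z = t * w)
    & P t = - delta%:Z].

Definition weierstrass_semigroup P (a : nat) : Prop :=
  exists f : F, has_pole_divisor f << a%:Z *g P >>.

End FunctionField.

Definition gap (H : nat -> Prop) (m : nat) : Prop := (0 < m)%N /\ ~ H m.

Definition biggest_gap (H : nat -> Prop) (m : nat) : Prop :=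
  gap H m /\ forall m', gap H m' -> (m' <= m)%N.

(* H has exactly g gaps, and the g-th one is 2g-1. *)
Definition symmetric_semigroup (H : nat -> Prop) (g : nat) : Prop :=
  exists s : seq nat,
    [/\ sorted ltn s, forall m, m \in s <-> gap H m, size s = g
      & nth 0%N s g.-1 = (2 * g - 1)%N].

Definition boseck0 (q delta : nat) : nat := (delta %/ q)%N.

Definition boseck_rem0 (q delta : nat) : nat := (delta %% q)%N.

(* Main.v *)
Require Import Defs.
From HB Require Import structures.
From mathcomp Require Import all_boot all_order all_fingroup all_algebra.
From mathcomp Require Import all_solvable all_field.
From mathcomp Require Import boolp freeg zify ring.

Set Implicit Arguments.
Unset Strict Implicit.
Unset Printing Implicit Defensive.

Import Order.TTheory GRing.Theory Num.Theory.
Local Open Scope ring_scope.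

(** Write q = p^n, and let y be a coordinate on the line with its pole at the
    branch point, so that y has a pole of order q at P0 and nowhere else.  Let R
    be the ring of functions that are regular away from P0, and Tr the trace
      from
    F to k(x).  The pole numbers at P0 are the pole orders of elements of R, and
    everything follows from one duality: with N = delta - 2 q + 1, an integer m
    is a pole number if and only if N - m is not ([pole_number_symmetry]).

    Both directions rest on the trace.  At P0, the definition of delta says that
    Tr z is regular as soon as v(z) >= - delta, and that it is not regular if
    v(z) = - delta - 1.  Away from P0 the cover is unramified, so that R is its
    own dual for the trace form ([regular_dual]): k(x) being dense in F at an
    unramified place P, the conjugates of P are distinct and can be separated by
    an element of R ([separate]), which lets one produce an element w of R such
    that Tr (z w) has a pole when z has one at P.

    - N is not a pole number: if f in R had a pole of order N, then Tr f would
      be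
      regular away from P0 and vanish at P0, hence be 0; but v(y^2 f) =
      - delta - 1, so that y^2 Tr f = Tr (y^2 f) is not 0.
    - If m is a gap, N - m is a pole number: for each class i modulo q choose
      f_i
      in R of least pole order a_i in this class.  The f_i form a basis of R
        over
      k[y] and, up to powers of 1/y, of each fractional ideal at P0.  Hence the
      dual basis for the trace form lies in R, and its element f'_i has pole
      order delta - q + 1 - a_i.  If m is a gap in the class of f_i, then
      a_i = m + q l with l > 0, and y^(l-1) f'_i has a pole of order N - m.

    So N is the largest gap, and half of the integers in [0, N] are gaps.  It
    remains to see that the number of gaps is the genus, i.e. the maximum of
    deg D - l(D) + 1 ([genus_eq_gaps]).  It is the value at D = c P0 for c
      large,
    because there is a basis of L(c P0) indexed by the pole numbers up to c
    ([basis_at_point]).  It is a bound for all D: starting from c P0 with c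
      large,
    each added point raises the dimension, since some function has a pole of
    prescribed order at one point and no other pole except at P0
    ([single_pole]); and each removed point lowers it by at most one
    ([riemann_inequality]).

    Two facts about the line are obtained indirectly.  Places are described by
    their restriction to k(y), which is governed by a pole or a zero of y - c
    ([local_parameter]).  That a nonzero function without poles cannot vanish at
    P0 is deduced from the finiteness of the genus ([genus_complete]). *)

(** * Valuations *)

Section Valuation.

Variables (k E : fieldType) (iota : {rmorphism k -> E}).

(** Here the value at 0 counts as +oo, so that these sets are closed under
    addition. *)
Definition vge (P : place iota) (n : int) (z : E) : bool :=
  (z == 0) || (n <= P z).

Section OnePlace.

Variable P : place iota.
Implicit Types (n m : int) (x y z w : E).

Lemma pval1 : P 1 = 0.
Proof. by rewrite -(rmorph1 iota) pvalC. Qed.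

Lemma pvalN z : P (- z) = P z.
Proof.
have [->|z0] := eqVneq z 0; first by rewrite oppr0.
have m1 : - 1 != 0 :> E by rewrite oppr_eq0 oner_eq0.
by rewrite -mulN1r pvalM // -(rmorph1 iota) -rmorphN pvalC add0r.
Qed.

Lemma pvalV z : P z^-1 = - P z.
Proof.
have [->|z0] := eqVneq z 0; first by rewrite invr0 pval0 oppr0.
apply/eqP; rewrite -addr_eq0 -pvalM ?invr_eq0 // mulVf //.
by rewrite pval1.
Qed.

Lemma pvalX z (m : nat) : P (z ^+ m) = m%:Z * P z.
Proof.
have [->|z0] := eqVneq z 0.
  by rewrite pval0 mulr0 expr0n; case: m => [|m]; rewrite ?pval1 ?pval0.
elim: m => [|m IHm]; first by rewrite expr0 pval1 mul0r.
by rewrite exprS pvalM ?expf_neq0 // IHm intS mulrDl mul1r.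
Qed.

Lemma pvalXz z n : P (z ^ n) = n * P z.
Proof.
case: n => m; first exact: pvalX.
by rewrite NegzE -exprnN pvalV pvalX mulNr.
Qed.

Lemma pval_gt0_neq0 z : 0 < P z -> z != 0.
Proof. by apply: contraTneq => ->; rewrite pval0 ltxx. Qed.

Lemma vge0 n : vge P n 0.
Proof. by rewrite /vge eqxx. Qed.

Lemma vgeE n z : z != 0 -> vge P n z = (n <= P z).
Proof. by rewrite /vge => /negPf->. Qed.

Lemma vge_pval z : vge P (P z) z.
Proof. by rewrite /vge lexx orbT. Qed.

Lemma vgeW n m z : n <= m -> vge P m z -> vge P n z.
Proof.
by move=> le_nm /orP[/eqP->|/(le_trans le_nm) h]; rewrite /vge ?eqxx ?h ?orbT.
Qed.

Lemma vgeN n z : vge P n (- z) = vge P n z.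
Proof. by rewrite /vge oppr_eq0 pvalN. Qed.

Lemma vgeD n y z : vge P n y -> vge P n z -> vge P n (y + z).
Proof.
have [->|y0] := eqVneq y 0; first by rewrite add0r.
have [->|z0] := eqVneq z 0; first by rewrite addr0.
have [->|yz0] := eqVneq (y + z) 0; first by rewrite vge0.
rewrite !vgeE // => hy hz; apply: le_trans (pvalD P y0 z0 yz0).
by rewrite le_min hy.
Qed.

Lemma vgeB n y z : vge P n y -> vge P n z -> vge P n (y - z).
Proof. by move=> hy hz; rewrite vgeD ?vgeN. Qed.

Lemma vgeM n m y z : vge P n y -> vge P m z -> vge P (n + m) (y * z).
Proof.
have [->|y0] := eqVneq y 0; first by rewrite mul0r !vge0.
have [->|z0] := eqVneq z 0; first by rewrite mulr0 !vge0.
by rewrite !vgeE ?mulf_neq0 // pvalM //; apply: lerD.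
Qed.

Lemma vge0M y z : vge P 0 y -> vge P 0 z -> vge P 0 (y * z).
Proof. by move=> hy hz; rewrite -[0]addr0 vgeM. Qed.

Lemma vgeMl n y z : y != 0 -> vge P n (y * z) = vge P (n - P y) z.
Proof.
move=> y0; have [->|z0] := eqVneq z 0; first by rewrite mulr0 !vge0.
by rewrite !vgeE ?mulf_neq0 // pvalM // lerBlDl.
Qed.

Lemma vge0X z (m : nat) : vge P 0 z -> vge P 0 (z ^+ m).
Proof.
move=> hz; have [->|z0] := eqVneq z 0.
  by rewrite expr0n; case: m => [|m]; rewrite ?vge0 // vgeE ?oner_eq0 ?pval1.
by rewrite vgeE ?expf_neq0 // pvalX mulr_ge0 // -vgeE.
Qed.

Lemma vgeC c : vge P 0 (iota c).
Proof. by rewrite /vge pvalC lexx orbT. Qed.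

Lemma vge1 : vge P 0 1.
Proof. by rewrite /vge pval1 lexx orbT. Qed.

Lemma vge_sum n (I : Type) (r : seq I) (A : pred I) (f : I -> E) :
  (forall i, A i -> vge P n (f i)) -> vge P n (\sum_(i <- r | A i) f i).
Proof. by move=> h; elim/big_ind: _ => //; [apply: vge0|apply: vgeD]. Qed.

Lemma vge0_prod (I : Type) (r : seq I) (A : pred I) (f : I -> E) :
  (forall i, A i -> vge P 0 (f i)) -> vge P 0 (\prod_(i <- r | A i) f i).
Proof. by move=> h; elim/big_ind: _ => //; [apply: vge1|apply: vge0M]. Qed.

Lemma pval_prod0 (I : Type) (r : seq I) (A : pred I) (f : I -> E) :
  (forall i, A i -> P (f i) = 0) -> P (\prod_(i <- r | A i) f i) = 0.
Proof.
move=> h; elim/big_ind: _ => // [|y z hy hz]; first exact: pval1.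
have [->|y0] := eqVneq y 0; first by rewrite mul0r pval0.
have [->|z0] := eqVneq z 0; first by rewrite mulr0 pval0.
by rewrite pvalM // hy hz.
Qed.

Lemma pvalDl z w : z != 0 -> vge P (P z + 1) w -> z + w != 0 /\ P (z + w) = P z.
Proof.
move=> z0; have [->|w0] := eqVneq w 0; first by rewrite addr0.
move=> hw; move: (hw); rewrite vgeE // => ltzw; have zw0 : z + w != 0.
  apply: contraTneq ltzw => /eqP; rewrite addr_eq0 => /eqP->.
  by rewrite pvalN; lia.
split=> //; apply/eqP; rewrite eq_le -[X in _ && X]vgeE //.
rewrite vgeD ?vge_pval ?andbT //; last by apply: vgeW hw; lia.
have [//|] := leP (P (z + w)) (P z); rewrite -lezD1 -vgeE // => /vgeB/(_ hw).
by rewrite addrK vgeE //; lia.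
Qed.

(** A sum of terms with distinct valuations cannot cancel: its valuation is the
    least one that occurs. *)
Lemma pval_sum (I : finType) (f : I -> E) :
    (forall i j, f i != 0 -> f j != 0 -> P (f i) = P (f j) -> i = j) ->
    (exists i, f i != 0) ->
  \sum_i f i != 0 /\ (forall i, f i != 0 -> P (\sum_j f j) <= P (f i)).
Proof.
move=> inj_f [i0 fi0].
case: (@Order.TotalTheory.arg_minP _ _ _ i0 (fun i => f i != 0)
         (fun i => P (f i)) fi0) => i nzi mini.
rewrite (bigD1 i) //=; case: (@pvalDl (f i) (\sum_(j | j != i) f j) nzi).
  2: by move=> nz ->; split.
apply: vge_sum => j ji; have [->|nzj] := eqVneq (f j) 0; first exact: vge0.
rewrite vgeE // lezD1 lt_neqAle mini // andbT.
by apply: contraNneq ji => /inj_f->.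
Qed.

(** An element satisfying an equation of integral dependence over the valuation
    ring lies in it: otherwise the leading power has a pole of higher order than
    all the other terms. *)
Lemma integral_vge0 (m : nat) (c : 'I_m -> E) z :
    z ^+ m = \sum_(i < m) c i * z ^+ i -> (forall i, vge P 0 (c i)) ->
  vge P 0 z.
Proof.
move=> eqz c_ge0; have [->|z0] := eqVneq z 0; first exact: vge0.
rewrite vgeE // leNgt; apply/negP => ltz0.
have: vge P (m%:Z * P z + 1) (z ^+ m).
  rewrite eqz; apply: vge_sum => i _; rewrite -[_ + 1]add0r vgeM //.
  rewrite vgeE ?expf_neq0 // pvalX; have := ltn_ord i; nia.
by rewrite vgeE ?expf_neq0 // pvalX; lia.
Qed.

Lemma integral_poly_vge0 (p : {poly E}) z :
  p \is monic -> (forall i, vge P 0 p`_i) -> root p z -> vge P 0 z.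
Proof.
move=> mon_p p_ge0 /rootP; rewrite horner_coef.
have sz_p : (0 < size p)%N by rewrite size_poly_gt0 monic_neq0.
rewrite -(prednK sz_p) big_ord_recr /= -lead_coefE (monicP mon_p) mul1r.
move/eqP; rewrite addrC addr_eq0 -sumrN => /eqP eqz.
apply: (@integral_vge0 (size p).-1 (fun i => - p`_i)) => [|i].
  by rewrite eqz; apply: eq_bigr => i _; rewrite mulNr.
by rewrite vgeN.
Qed.

Lemma vge0_horner (h : {poly E}) z :
  (forall i, vge P 0 h`_i) -> vge P 0 z -> vge P 0 h.[z].
Proof.
move=> h_ge0 z_ge0; rewrite horner_coef; apply: vge_sum => i _.
by rewrite vge0M ?vge0X.
Qed.

Lemma vge0_prodXsubC (s : seq E) :
    (forall z, z \in s -> vge P 0 z) ->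
  forall i, vge P 0 (\prod_(z <- s) ('X - z%:P))`_i.
Proof.
elim: s => [|z s IHs] hs i.
  by rewrite big_nil coef1; case: (i == _); rewrite ?vge0 ?vge1.
have {}IHs : forall j, vge P 0 (\prod_(w <- s) ('X - w%:P))`_j.
  by apply: IHs => w ws; rewrite hs // inE ws orbT.
rewrite big_cons mulrC mulrBr coefB coefMX coefMC vgeB //.
  by case: (i == _); rewrite ?vge0.
by rewrite vge0M // hs ?mem_head.
Qed.

End OnePlace.

Lemma eq_place (P P' : place iota) : P =1 P' -> P = P'.
Proof.
case: P => v v0 vM vD vC v1; case: P' => w w0 wM wD wC w1 /= /funext eqvw.
by subst w; congr Place; apply: Prop_irrelevance.
Qed.

(** Discrete valuation rings are maximal subrings: an inclusion between two of
    them is an equality, and it determines the place. *)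
Lemma place_eq_of_sub (P P' : place iota) :
  (forall z, z != 0 -> 0 <= P z -> 0 <= P' z) -> P = P'.
Proof.
move=> sub.
have unit z : z != 0 -> P z = 0 -> P' z = 0.
  move=> z0 Pz0; apply/eqP; rewrite eq_le (sub z) ?Pz0 // andbT -oppr_ge0.
  by rewrite -pvalV sub ?invr_eq0 // pvalV Pz0.
have [t t0 Pt] := pval_surj P.
have val z : z != 0 -> P' z = P z * P' t.
  move=> z0; have := @unit (z * t ^ (- P z)).
  have nz : t ^ (- P z) != 0 by rewrite expfz_neq0.
  rewrite mulf_neq0 // !pvalM // !pvalXz => /(_ isT).
  by rewrite Pt mulr1 subrr mulNr => /(_ erefl)/eqP; rewrite subr_eq0 => /eqP.
have [t' t'0 P't'] := pval_surj P'.
have Pt_ge0 : 0 <= P' t by rewrite sub ?Pt.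
have P't : P' t = 1.
  have := val t' t'0; rewrite P't'; move: (P t') (P' t) Pt_ge0 => a b b0 eq1.
  have b1 : 0 < b by rewrite lt_neqAle b0 andbT; apply/eqP; nia.
  have a1 : 0 < a by nia.
  by nia.
apply: eq_place => z; have [->|z0] := eqVneq z 0; first by rewrite !pval0.
by rewrite val // P't mulr1.
Qed.

End Valuation.
(** * Rational expressions in one element, and their expansion at a place *)

Section Rational.

Variables (k E : fieldType) (iota : {rmorphism k -> E}).
Implicit Types (u z : E) (h : {poly k}) (P : place iota).

Definition peval h u : E := (map_poly iota h).[u].

Definition rational_in u z : Prop :=
  exists h1 h2, peval h2 u != 0 /\ z = peval h1 u / peval h2 u.

Lemma pevalD h1 h2 u : peval (h1 + h2) u = peval h1 u + peval h2 u.
Proof. by rewrite /peval rmorphD hornerD. Qed.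

Lemma pevalM h1 h2 u : peval (h1 * h2) u = peval h1 u * peval h2 u.
Proof. by rewrite /peval rmorphM hornerM. Qed.

Lemma pevalC c u : peval c%:P u = iota c.
Proof. by rewrite /peval map_polyC hornerC. Qed.

Lemma pevalX u : peval 'X u = u.
Proof. by rewrite /peval map_polyX hornerX. Qed.

Lemma peval0 u : peval 0 u = 0.
Proof. by rewrite /peval rmorph0 horner0. Qed.

Lemma peval1 u : peval 1 u = 1.
Proof. by rewrite /peval rmorph1 hornerC. Qed.

Lemma peval_prod (I : Type) (r : seq I) (A : pred I) (f : I -> {poly k}) u :
  peval (\prod_(i <- r | A i) f i) u = \prod_(i <- r | A i) peval (f i) u.
Proof. by rewrite /peval rmorph_prod horner_prod. Qed.

Lemma rational_in_peval u h : rational_in u (peval h u).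
Proof. by exists h, 1; rewrite peval1 oner_eq0 divr1. Qed.

Lemma rational_inC u c : rational_in u (iota c).
Proof. by rewrite -(pevalC c u); apply: rational_in_peval. Qed.

Lemma rational_in_id u : rational_in u u.
Proof. by rewrite -{2}(pevalX u); apply: rational_in_peval. Qed.

Lemma rational_inD u y z :
  rational_in u y -> rational_in u z -> rational_in u (y + z).
Proof.
move=> [a [b [b0 ->]]] [c [d [d0 ->]]]; exists (a * d + c * b), (b * d).
by rewrite pevalD !pevalM mulf_neq0 ?addf_div.
Qed.

Lemma rational_inM u y z :
  rational_in u y -> rational_in u z -> rational_in u (y * z).
Proof.
move=> [a [b [b0 ->]]] [c [d [d0 ->]]]; exists (a * c), (b * d).
by rewrite !pevalM mulf_neq0 ?mulf_div.
Qed.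

Lemma rational_inV u z : rational_in u z -> rational_in u z^-1.
Proof.
move=> [a [b [b0 ->]]]; have [a0|a0] := eqVneq (peval a u) 0.
  by rewrite a0 mul0r invr0 -(rmorph0 iota); apply: rational_inC.
by exists b, a; rewrite invf_div.
Qed.

Lemma rational_in_trans u y z :
  rational_in u y -> rational_in y z -> rational_in u z.
Proof.
move=> uy [a [b [_ ->]]]; suff ev h : rational_in u (peval h y).
  by apply: rational_inM => //; apply: rational_inV.
elim/poly_ind: h => [|h c IHh].
  by rewrite peval0 -(peval0 u); apply: rational_in_peval.
rewrite pevalD pevalM pevalX pevalC.
apply: rational_inD; last exact: rational_inC.
exact: rational_inM.
Qed.

Lemma vge0_peval P h u : vge P 0 u -> vge P 0 (peval h u).
Proof. by apply: vge0_horner => i; rewrite coef_map vgeC. Qed.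

Lemma vge1_peval_sub P h u : 0 < P u -> vge P 1 (peval h u - iota h`_0).
Proof.
move=> Pu; elim/poly_ind: h => [|h c IHh].
  by rewrite coef0 peval0 rmorph0 subrr vge0.
rewrite pevalD pevalM pevalX pevalC coefD coefMX coefC /= add0r addrK.
rewrite -[1]add0r vgeM //; last by rewrite /vge [1 <= _]Pu orbT.
by apply: vge0_peval; rewrite /vge (ltW Pu) orbT.
Qed.

Lemma pval_peval_unit P c z :
  c != 0 -> vge P 1 (z - iota c) -> z != 0 /\ P z = 0.
Proof.
move=> c0 hz; have ic0 : iota c != 0 by rewrite fmorph_eq0.
by have := @pvalDl _ _ _ P (iota c) (z - iota c) ic0; rewrite pvalC subrKC;
  apply.
Qed.

Lemma peval_expansion h u : h != 0 -> exists (j : int) (c : k), c != 0 /\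
  forall P, 0 < P u -> vge P 1 (peval h u * u ^ (- j) - iota c).
Proof.
move=> h0; have [m [h' h'0 eqh]] := multiplicity_XsubC h 0.
exists m%:Z, h'`_0; split=> [|P Pu].
  by move: h'0; rewrite h0 /root -horner_coef0.
have u0 := pval_gt0_neq0 Pu.
rewrite eqh pevalM subr0 /peval rmorphXn /= map_polyX hornerXn -mulrA.
by rewrite -exprnN divff ?expf_neq0 // mulr1 vge1_peval_sub.
Qed.

(** The leading term c u^j of the expansion in powers of u is the same at all
    places where u vanishes; this uniformity is what allows to compare places
    with the same centre. *)
Lemma rational_expansion u z : rational_in u z -> z != 0 ->
  exists (j : int) (c : k), c != 0 /\
    forall P, 0 < P u -> vge P 1 (z * u ^ (- j) - iota c).
Proof.
move=> [a [b [b0 ->]]] ab0; have a0 : a != 0.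
  by apply: contraNneq ab0 => ->; rewrite peval0 mul0r.
have {}b0 : b != 0.
  by apply: contraNneq b0 => ->; rewrite peval0.
have [i [c [c0 ha]]] := peval_expansion u a0.
have [j [d [d0 hb]]] := peval_expansion u b0.
exists (i - j), (c / d); split=> [|P Pu]; first by rewrite mulf_neq0 ?invr_eq0.
have u0 := pval_gt0_neq0 Pu.
have {}ha := ha P Pu; have {}hb := hb P Pu.
set A := _ * _ in ha; set B := _ * _ in hb.
have [nzB PB] := pval_peval_unit d0 hb.
have id0 : iota d != 0 by rewrite fmorph_eq0.
have -> : peval a u / peval b u * u ^ (- (i - j)) = A / B.
  by rewrite /A /B opprB expfzDr // invfM invr_expz opprK
    [RHS]mulrACA [u ^ j * _]mulrC.
have -> : A / B - iota (c / d) =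
    ((A - iota c) * iota d - (B - iota d) * iota c) * (B^-1 * (iota d)^-1).
  rewrite rmorphM fmorphV; move: nzB id0; clear; by move=> ? ?; field;
    apply/andP.
rewrite -[1]addr0 vgeM ?vge0M //; first last.
- by rewrite -fmorphV vgeC.
- by rewrite vgeE ?invr_eq0 // pvalV PB.
by rewrite vgeB // -[1]addr0 vgeM ?vgeC.
Qed.

Lemma rational_pval u z : rational_in u z -> z != 0 ->
  exists j : int, forall P, 0 < P u -> P z = j * P u.
Proof.
move=> uz z0; have [j [c [c0 hz]]] := rational_expansion uz z0.
exists j => P Pu; have u0 := pval_gt0_neq0 Pu.
have [_] := pval_peval_unit c0 (hz P Pu).
rewrite pvalM ?expfz_neq0 // pvalXz => /eqP.
by rewrite mulNr subr_eq0 => /eqP.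
Qed.

End Rational.

Section LocalParameter.

Variables (k : closedFieldType) (E : fieldType) (iota : {rmorphism k -> E}).

Lemma pval_peval_eq0 (P : place iota) (u : E) (h : {poly k}) :
  (forall c, P (u - iota c) = 0) -> P (peval iota h u) = 0.
Proof.
move=> Pu; have [r ->] := closed_field_poly_normal h.
rewrite -mul_polyC pevalM pevalC peval_prod.
have Pr : P (\prod_(z <- r) peval iota ('X - z%:P) u) = 0.
  by apply: pval_prod0 => c _; rewrite /peval map_polyXsubC hornerXsubC Pu.
have [->|nz] := eqVneq (\prod_(z <- r) peval iota ('X - z%:P) u) 0.
  by rewrite mulr0 pval0.
have [->|h0] := eqVneq (lead_coef h) 0; first by rewrite rmorph0 mul0r pval0.
by rewrite pvalM ?fmorph_eq0 // Pr pvalC.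
Qed.

Lemma peval_neq0 (u : E) (h : {poly k}) :
  (forall c, u != iota c) -> h != 0 -> peval iota h u != 0.
Proof.
move=> u_c; have [r ->] := closed_field_poly_normal h.
rewrite -mul_polyC mulf_eq0 polyC_eq0 negb_or => /andP[h0 _].
rewrite pevalM pevalC peval_prod mulf_neq0 ?fmorph_eq0 //.
rewrite prodf_seq_neq0; apply/allP => c _ /=.
by rewrite /peval map_polyXsubC hornerXsubC subr_eq0.
Qed.

(** On the projective line with coordinate u, a place is either u = oo or
    u = c: as k is algebraically closed, these are the only ways in which the
    place can be nontrivial on k(u). *)
Lemma local_parameter (P : place iota) (u z : E) :
  rational_in iota u z -> P z != 0 -> P u < 0 \/ exists c, 0 < P (u - iota c).
Proof.
move=> [a [b [_ ->]]] nzPz; have [|Pu] := ltP (P u) 0; first by left.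
right; apply: contrapT => no_c; case/eqP: nzPz.
have u_c c : P (u - iota c) = 0.
  have [->|uc0] := eqVneq (u - iota c) 0; first exact: pval0.
  apply/eqP; rewrite eq_le leNgt; apply/andP; split.
    by apply/negP => uc; apply: no_c; exists c.
  by rewrite -vgeE // vgeB ?vgeC // /vge Pu orbT.
have [->|a0] := eqVneq (peval iota a u) 0; first by rewrite mul0r pval0.
have [->|b0] := eqVneq (peval iota b u) 0; first by rewrite invr0 mulr0 pval0.
by rewrite pvalM ?invr_eq0 // pvalV !pval_peval_eq0.
Qed.

End LocalParameter.

(** ** Linear independence over the constants *)

Section ConstFree.

Variables (k E : fieldType) (iota : {rmorphism k -> E}).

Definition const_free n (b : 'I_n -> E) : Prop :=
  forall c : 'I_n -> k, \sum_i iota (c i) * b i = 0 -> forall i, c i = 0.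

Lemma const_free_neq0 n (b : 'I_n -> E) i : const_free b -> b i != 0.
Proof.
move=> freeb; apply/eqP => b0; have := freeb (fun j => (j == i)%:R).
rewrite (bigD1 i) //= b0 mulr0 add0r big1 => [/(_ erefl i)/eqP|j].
  by rewrite eqxx oner_eq0.
by move/negPf->; rewrite rmorph0 mul0r.
Qed.

Lemma const_free_pval (P : place iota) n (b : 'I_n -> E) : (forall i, b i != 0)
  ->
  injective (fun i => P (b i)) -> const_free b.
Proof.
move=> b0 injP c sum0 i; apply/eqP/negPn/negP => ci.
have val j : iota (c j) * b j != 0 -> P (iota (c j) * b j) = P (b j).
  rewrite mulf_eq0 negb_or => /andP[cj bj].
  by rewrite pvalM // pvalC add0r.
case: (@pval_sum _ _ _ P _ (fun j => iota (c j) * b j)) => [j l nzj nzl||].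
- by rewrite !val //; apply: injP.
- by exists i; rewrite mulf_neq0 ?b0 ?(fmorph_eq0 iota).
- by rewrite sum0 eqxx.
Qed.

Lemma const_free_leq m n (e : 'I_m -> E) (b : 'I_n -> E)
    (C : 'I_n -> 'I_m -> k) :
  (forall i, b i = \sum_j iota (C i j) * e j) -> const_free b -> (n <= m)%N.
Proof.
move=> hC freeb; rewrite leqNgt; apply/negP => lt_mn.
pose M := \matrix_(i < n, j < m) C i j.
have : kermx M != 0.
  rewrite kermx_eq0 /row_free neq_ltn; apply/orP; left.
  exact: leq_ltn_trans (rank_leq_col M) lt_mn.
case/rowV0Pn => v /sub_kermxP vM; apply/negP; rewrite negbK;
  apply/eqP/rowP => i.
rewrite mxE; apply: (freeb (fun i => v 0 i)).
transitivity (\sum_j iota ((v *m M) 0 j) * e j); last first.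
  by apply: big1 => j _; rewrite vM mxE rmorph0 mul0r.
under eq_bigr => l _ do rewrite hC mulr_sumr.
rewrite exchange_big /=; apply: eq_bigr => j _.
rewrite mxE rmorph_sum mulr_suml; apply: eq_bigr => l _.
by rewrite mxE rmorphM mulrA.
Qed.

End ConstFree.
(** * Galois extensions of a field generated by one coordinate *)

Section Extension.

(** Here K stands for the rational function field k(x), and L for the function
    field of the curve. *)
Variables (k : closedFieldType) (K : fieldType) (L : splittingFieldType K).
Variables (kappa : {rmorphism k -> K}) (iota : {rmorphism k -> L}).
Hypothesis iotaE : forall c, iota c = (kappa c)%:A.
Implicit Types (P : place iota) (z b : L) (a u : K).

Local Notation Gal := 'Gal({:L}%AS / 1%AS)%g.
Local Notation Tr := (galTrace 1%AS {:L}%AS).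

Lemma memv1P z : reflect (exists a, z = a%:A) (z \in 1%VS).
Proof. exact: vlineP. Qed.

Lemma alg_eq0 a : ((a%:A : L) == 0) = (a == 0).
Proof. exact: (fmorph_eq0 (in_alg L)). Qed.

Lemma algM a u : ((a * u)%:A : L) = a%:A * u%:A.
Proof. exact: (rmorphM (in_alg L)). Qed.

Lemma algV a : (a^-1%:A : L) = a%:A^-1.
Proof. exact: (fmorphV (in_alg L)). Qed.

Lemma algB a u : ((a - u)%:A : L) = a%:A - u%:A.
Proof. exact: scalerBl. Qed.

Lemma algBC a c : ((a - kappa c)%:A : L) = a%:A - iota c.
Proof. by rewrite algB iotaE. Qed.

Lemma coef_minPoly1 z i : exists a, (minPoly 1%AS z)`_i = a%:A.
Proof.
have /polyOverP/(_ i) h := minPolyOver 1%AS z.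
exact/memv1P/h.
Qed.

(** L is algebraic over K, so a place that is trivial on K would have no
    poles at all. *)
Lemma place_nontrivial P : exists a, P a%:A != 0.
Proof.
apply: contrapT => triv; have {}triv a : P a%:A = 0.
  by apply/eqP/negPn/negP => h; apply: triv; exists a.
have [t t0 Pt] := pval_surj P.
have := @integral_poly_vge0 _ _ _ P (minPoly 1%AS t^-1) t^-1.
rewrite monic_minPoly root_minPoly vgeE ?invr_eq0 // pvalV Pt.
suff h i : vge P 0 (minPoly 1 t^-1)`_i by move/(_ isT h isT).
have [a ->] := coef_minPoly1 t^-1 i.
by rewrite /vge triv lexx orbT.
Qed.

Definition coordinate (y : K) : Prop :=
  forall a, rational_in iota y%:A (a%:A : L).

(** A place of L is centred, on the projective line with coordinate y, at oo or
    at a finite point c; then 1/y or y - c generates K and vanishes there. *)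
Lemma coordinate_center y P : coordinate y ->
  P y%:A < 0 \/ exists c, 0 < P (y - kappa c)%:A.
Proof.
move=> coord_y; have [a Pa] := place_nontrivial P.
have [|[c Pc]] := local_parameter (coord_y a) Pa; first by left.
by right; exists c; rewrite algBC; exact: Pc.
Qed.

Lemma coordinateV y : coordinate y -> coordinate y^-1.
Proof.
move=> cy a; apply: rational_in_trans (cy a).
have -> : y%:A = (y^-1%:A)^-1 :> L by rewrite algV invrK.
exact/rational_inV/rational_in_id.
Qed.

Lemma coordinateBC y c : coordinate y -> coordinate (y - kappa c).
Proof.
move=> cy a; apply: rational_in_trans (cy a).
have -> : y%:A = (y - kappa c)%:A + iota c :> L.
  by rewrite algBC subrK.
by apply: rational_inD; [apply: rational_in_id|apply: rational_inC].
Qed.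

Lemma gal_all (s : gal_of {:L}) : s \in Gal.
Proof.
rewrite gal_kHom ?sub1v //; apply/kAHomP => z /memv1P[a ->].
by rewrite linearZ /= rmorph1.
Qed.

Lemma gal_alg (s : gal_of {:L}) a : s a%:A = a%:A.
Proof. by rewrite linearZ /= rmorph1. Qed.

Lemma galM_app (s t : gal_of {:L}) z : (s * t)%g z = t (s z).
Proof. by rewrite galM ?memvf. Qed.

Lemma galK_app (s : gal_of {:L}) z : s (s^-1%g z) = z.
Proof. by rewrite -galM_app mulVg gal_id. Qed.

Lemma gal_eq0 (s : gal_of {:L}) z : (s z == 0) = (z == 0).
Proof. exact: fmorph_eq0. Qed.

Definition conj_place P (s : gal_of {:L}) : place iota.
Proof.
refine (@Place _ _ iota (fun z => P (s z)) _ _ _ _ _).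
- by rewrite rmorph0 pval0.
- by move=> y z y0 z0; rewrite rmorphM pvalM ?gal_eq0.
- by move=> y z y0 z0 yz0; rewrite rmorphD pvalD ?gal_eq0 // -rmorphD gal_eq0.
- by move=> c; rewrite iotaE gal_alg -iotaE pvalC.
- have [t t0 Pt] := pval_surj P; exists (s^-1%g t); first by rewrite gal_eq0.
  by rewrite galK_app.
Defined.

Lemma conj_placeE P s z : conj_place P s z = P (s z).
Proof. by []. Qed.

Lemma vge_conj P s n z : vge (conj_place P s) n z = vge P n (s z).
Proof. by rewrite /vge gal_eq0. Qed.

Lemma trE z : Tr z = \sum_(s in Gal) s z.
Proof. by []. Qed.

Lemma tr_algM a z : Tr (a%:A * z) = a%:A * Tr z.
Proof.
by rewrite !trE mulr_sumr; apply: eq_bigr => s _; rewrite rmorphM /= gal_alg.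
Qed.

Hypothesis gal_L : galois 1%AS {:L}%AS.

Lemma tr_alg z : exists a, Tr z = a%:A.
Proof. by apply/memv1P; apply: mem_galTrace => //; apply: memvf. Qed.

Lemma coef_minPoly1_vge0 P b i :
  (forall s : gal_of {:L}, vge P 0 (s b)) -> vge P 0 (minPoly 1%AS b)`_i.
Proof.
move=> Pb; have [r [_ _ ->]] := galois_factors (sub1v _) gal_L b (memvf b).
by apply: vge0_prodXsubC => z /mapP[s _ ->].
Qed.

(** If all conjugates of b are regular at P, then b is integral over the local
    ring below P, since the coefficients of its minimal polynomial are in it;
    so b is regular at all places P' with the same centre as P. *)
Lemma integral_conj P P' b :
    (forall a, vge P 0 a%:A -> vge P' 0 a%:A) ->
    (forall s : gal_of {:L}, vge P 0 (s b)) ->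
  vge P' 0 b.
Proof.
move=> PP' Pb; apply: (@integral_poly_vge0 _ _ _ P' (minPoly 1%AS b)).
- exact: monic_minPoly.
- move=> i; have [a eqa] := coef_minPoly1 b i.
  by rewrite eqa; apply: PP'; rewrite -eqa coef_minPoly1_vge0.
- exact: root_minPoly.
Qed.

End Extension.
(** * Covers of the line with one branch point, totally ramified *)

Lemma mod_inj (n a b : nat) (m : int) :
  (a < n)%N -> (b < n)%N -> a%:Z = b%:Z + n%:Z * m -> a = b.
Proof.
move=> an bn eqab; suff m0 : m = 0 by move: eqab; rewrite m0 mulr0; lia.
by have [?|?|//] := ltrgtP m 0; nia.
Qed.

Section OneBranchPoint.

Variables (k : closedFieldType) (K : fieldType) (L : splittingFieldType K).
Variables (kappa : {rmorphism k -> K}) (iota : {rmorphism k -> L}).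
Hypothesis iotaE : forall c, iota c = (kappa c)%:A.
Implicit Types (P : place iota) (z w : L).

Local Notation q := (\dim {:L}).

(** The geometry enters the sequel through these clauses only: P0 is totally
    ramified above y = oo, the other places are unramified over k(y), and the
    last clause carries the completeness of the curve. *)
Record one_branch_point (y : K) (P0 : place iota) : Prop := OneBranchPoint {
  branch_galois : galois 1%AS {:L}%AS;
  branch_coordinate : coordinate iota y;
  branch_total : forall a : K, exists j : int, P0 a%:A = q%:Z * j;
  branch_pole : P0 y%:A = - q%:Z;
  branch_unramified : forall P : place iota, P <> P0 ->
    forall u : K, coordinate iota u -> 0 < P u%:A -> P u%:A = 1;
  branch_complete : forall z : L, (forall P : place iota, vge P 0 z) -> P0 z <=
    0 }.

Lemma q_gt0 : (0 < q)%N. Proof. exact: adim_gt0. Qed.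

Lemma residueK P u (b : K) : coordinate iota u -> 0 < P u%:A ->
  vge P 0 (b%:A : L) -> exists c, vge P 1 (b%:A - iota c).
Proof.
move=> cu Pu b_ge0; have [->|b0] := eqVneq b 0.
  by exists 0; rewrite scale0r rmorph0 subr0 vge0.
have b0' : b%:A != 0 :> L by rewrite alg_eq0.
have [j [c [c0 /(_ P Pu) hc]]] := rational_expansion (cu b) b0'.
have u0 := pval_gt0_neq0 Pu.
have [nz] := pval_peval_unit c0 hc.
move: b_ge0; rewrite vgeE // pvalM ?expfz_neq0 // pvalXz mulNr => Pb /eqP.
rewrite subr_eq0 => /eqP eqPb; have [j0|j0] := eqVneq j 0.
  by exists c; move: hc; rewrite j0 oppr0 expr0z mulr1.
exists 0; rewrite rmorph0 subr0 vgeE //.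
by move: Pb j0 Pu; rewrite eqPb; move: (P u%:A) => e; nia.
Qed.

(** The residue field at any place is k: an algebraic relation over K, scaled to
    be primitive at P, reduces to one over k, which is algebraically closed. *)
Lemma residue P u z : coordinate iota u -> 0 < P u%:A -> vge P 0 z ->
  exists c, vge P 1 (z - iota c).
Proof.
move=> cu Pu z_ge0; apply: contrapT => no_c.
have z_c c : z != iota c.
  by apply/eqP => z_c; apply: no_c; exists c; rewrite z_c subrr vge0.
have z_c0 c : P (z - iota c) = 0.
  have zc : z - iota c != 0 by rewrite subr_eq0.
  apply/eqP; rewrite eq_le -[X in _ && X]vgeE // vgeB ?vgeC // andbT leNgt.
  by apply/negP => h; apply: no_c; exists c; rewrite vgeE.
set p := minPoly 1%AS z.
have [m [sz_p mon_p]] : exists m, size p = m.+1 /\ p`_m = 1.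
  exists (size p).-1; have mon_p := monic_minPoly 1%AS z.
  by rewrite prednK ?size_poly_gt0 ?monic_neq0 // -lead_coefE (monicP mon_p).
pose i0 : 'I_m.+1 := ord_max.
have nz_i0 : p`_i0 != 0 by rewrite mon_p oner_eq0.
(* Dividing by a coefficient of least valuation makes the others regular at P
   without all of their residues being zero. *)
case: (@Order.TotalTheory.arg_minP _ _ _ i0 (fun i : 'I_m.+1 => p`_i != 0)
         (fun i => P p`_i) nz_i0) => i nzi mini.
have /fin_all_exists[b hb] (l : 'I_m.+1) : exists b : K, p`_l / p`_i = b%:A.
  have [[a ->] [a' ->]] := (coef_minPoly1 z l, coef_minPoly1 z i).
  by exists (a / a'); rewrite algM algV.
have b_ge0 l : vge P 0 (b l)%:A.
  rewrite -hb; have [->|nzl] := eqVneq p`_l 0; first by rewrite mul0r vge0.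
  by rewrite vgeE ?mulf_neq0 ?invr_eq0 // pvalM ?invr_eq0 // pvalV subr_ge0
    mini.
have /fin_all_exists[c hc] l := residueK cu Pu (b_ge0 l).
pose h : {poly k} := \poly_(l < m.+1) c (inord l).
have h0 : h != 0.
  apply: contraTneq (hc i) => /polyP/(_ i); rewrite coef_poly ltn_ord inord_val.
  by rewrite coef0 => ->; rewrite rmorph0 subr0 -hb divff // vgeE ?oner_eq0 //
    pval1.
have nzh : peval iota h z != 0 by apply: peval_neq0.
have : vge P 1 (peval iota h z).
  have -> : peval iota h z = \sum_(l < m.+1) (iota (c l) - (b l)%:A) * z ^+ l.
    transitivity (\sum_(l < m.+1) iota (c l) * z ^+ l).
      rewrite /peval (@horner_coef_wide _ m.+1) ?size_map_poly ?size_poly //.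
      by apply: eq_bigr => l _; rewrite coef_map coef_poly ltn_ord inord_val.
    apply/eqP; rewrite -subr_eq0 -sumrB; apply/eqP.
    transitivity (p.[z] / p`_i); last first.
      by have /rootP := root_minPoly 1%AS z; rewrite -/p => ->; rewrite mul0r.
    rewrite horner_coef sz_p mulr_suml; apply: eq_bigr => l _.
    by rewrite -hb mulrBl opprB addrC subrK mulrAC.
  apply: vge_sum => l _; rewrite -[1]addr0 vgeM ?vge0X //.
  by rewrite -vgeN opprB.
by rewrite vgeE // pval_peval_eq0.
Qed.

Lemma residue_at y P z : coordinate iota y -> vge P 0 z ->
  exists c, vge P 1 (z - iota c).
Proof.
move=> cy; have [Py|[c Pc]] := coordinate_center iotaE P cy.
  by apply: (@residue P y^-1); [apply: coordinateV|rewrite algV pvalV oppr_gt0].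
by apply: residue Pc; apply: coordinateBC.
Qed.

(** ** Bases adapted to a totally ramified place *)

Section AdaptedBasis.

Variable P0 : place iota.
Hypothesis total : forall a : K, exists j : int, P0 a%:A = q%:Z * j.

Variable b : 'I_q -> L.
Hypotheses (b0 : forall i, b i != 0).
Hypothesis b_mod : forall i j (m : int), P0 (b i) = P0 (b j) + q%:Z * m -> i =
  j.

Lemma adapted_pval (c : 'I_q -> K) i : c i != 0 ->
  \sum_j c j *: b j != 0 /\
  P0 (\sum_j c j *: b j) <= P0 (c i)%:A + P0 (b i).
Proof.
move=> ci; have nz j : (c j *: b j != 0) = (c j != 0).
  by rewrite scaler_eq0 (negPf (b0 j)) orbF.
have val j : c j != 0 -> P0 (c j *: b j) = P0 (c j)%:A + P0 (b j).
  by move=> cj; rewrite -[c j *: b j]mulr_algl pvalM // alg_eq0.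
case: (@pval_sum _ _ _ P0 _ (fun j => c j *: b j)) => [j l||nzs le_s].
- rewrite !nz => cj cl; rewrite !val //.
  have [[m ->] [m' ->]] := (total (c j), total (c l)) => eqv.
  by apply: (@b_mod j l (m' - m)); move: eqv; rewrite mulrBr; lia.
- by exists i; rewrite nz.
- by split=> //; rewrite -val // le_s ?nz.
Qed.

Lemma adapted_coord z : exists c : 'I_q -> K, z = \sum_j c j *: b j.
Proof.
pose X := [tuple b i | i < q].
have XE (i : 'I_q) : X`_i = b i by rewrite (nth_map i) ?size_enum_ord
  ?nth_ord_enum.
have freeX : free X.
  apply/freeP => c eq0 i; apply/eqP/negPn/negP => ci.
  have [] := @adapted_pval c i ci; rewrite -[X in X != 0]/(\sum_j c j *: b j).
  suff -> : \sum_j c j *: b j = 0 by rewrite eqxx.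
  by rewrite -[RHS]eq0; apply: eq_bigr => j _; rewrite XE.
have basX : basis_of {:L} X.
  by rewrite basisEfree freeX subvf size_tuple /=.
exists (fun i => coord X i z); rewrite {1}(coord_basis basX (memvf z)).
by apply: eq_bigr => j _; rewrite XE.
Qed.

End AdaptedBasis.

(** ** The ramified place is stable, and the only one at infinity *)

Variables (y : K) (P0 : place iota).
Hypothesis branch : one_branch_point y P0.

Let total := branch_total branch.
Let cy := branch_coordinate branch.

Lemma y_neq0 : y%:A != 0 :> L.
Proof.
apply: contraTneq q_gt0 => y0; have := branch_pole branch.
by rewrite y0 pval0; lia.
Qed.

(** The local ring at P0 is generated over the local ring below by a
    uniformizer s, which is integral over it; hence a place which is regular on
    the local ring below is regular on the local ring at P0. *)
Lemma pole_unique P : P y%:A < 0 -> P = P0.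
Proof.
move=> Py; have [s s0 P0s] := pval_surj P0.
pose b (i : 'I_q) := s ^+ i.
have b0 i : b i != 0 by rewrite expf_neq0.
have b_mod i j m : P0 (b i) = P0 (b j) + q%:Z * m -> i = j.
  rewrite !pvalX P0s; have := ltn_ord i; have := ltn_ord j.
  by rewrite !mulr1 => hj hi /(mod_inj hi hj)/val_inj.
have P0K (a : K) : 0 <= P0 a%:A -> vge P 0 a%:A.
  have [->|a0] := eqVneq a 0; first by rewrite scale0r vge0.
  have a0' : a%:A != 0 :> L by rewrite alg_eq0.
  have [j hj] := rational_pval (coordinateV cy a) a0'.
  have pos (R : place iota) : R y%:A < 0 -> 0 < R y^-1%:A.
    by rewrite algV pvalV oppr_gt0.
  have P0y : P0 y%:A < 0 by rewrite (branch_pole branch); have := q_gt0; lia.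
  rewrite vgeE // (hj _ (pos _ P0y)) (hj _ (pos _ Py)).
  have := pos _ P0y; have := pos _ Py.
  by move: (P _) (P0 _) => e e0; nia.
have coordP z : 0 <= P0 z -> exists2 c : 'I_q -> K,
    z = \sum_j c j *: s ^+ j & forall i, vge P 0 (c i)%:A.
  have [c ->] := adapted_coord total b0 b_mod z => z_ge0.
  exists c => // i; have [->|ci] := eqVneq (c i) 0;
    first by rewrite scale0r vge0.
  apply: P0K; have [_] := adapted_pval total b0 b_mod ci.
  have [j ->] := total (c i); rewrite /b pvalX P0s.
  move: z_ge0; rewrite /b; move: (P0 (\sum_j _)) => v v_ge0.
  move=> le_v; have lt_i := ltn_ord i; rewrite mulr_ge0 //.
  have : 0 < q%:Z * (j + 1) by move: lt_i v_ge0 le_v; rewrite mulr1; lia.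
  by rewrite pmulr_rgt0 ?ltz_nat ?q_gt0 //; lia.
have P_s : vge P 0 s.
  have [|c eqs c_ge0] := coordP (s ^+ q); first by rewrite pvalX P0s mulr1.
  apply: (@integral_vge0 _ _ _ P q (fun i => (c i)%:A)) => //.
  by rewrite eqs; apply: eq_bigr => i _; rewrite mulr_algl.
apply/esym/place_eq_of_sub => z z0 /coordP[c -> c_ge0].
have [->|nz] := eqVneq (\sum_j c j *: s ^+ j) 0; first by rewrite pval0.
rewrite -vgeE //; apply: vge_sum => i _.
by rewrite -mulr_algl vge0M ?vge0X.
Qed.

Lemma vge0_y P : P <> P0 -> vge P 0 y%:A.
Proof. by rewrite vgeE ?y_neq0 // leNgt => h; apply/negP => /pole_unique. Qed.

Lemma conj_place0 s : conj_place iotaE P0 s = P0.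
Proof.
apply: pole_unique; rewrite conj_placeE gal_alg (branch_pole branch).
by have := q_gt0; lia.
Qed.

Lemma pval0_conj (s : gal_of {:L}) z : P0 (s z) = P0 z.
Proof. by rewrite -(conj_placeE iotaE P0 s) conj_place0. Qed.

Lemma conj_place_neq P s : P <> P0 -> conj_place iotaE P s <> P0.
Proof.
move=> PP0 h; apply: PP0; apply: eq_place => z.
by rewrite -(galK_app s z) -(conj_placeE iotaE P) h [RHS]pval0_conj.
Qed.

(** ** The ring of functions regular away from the ramified place *)

Definition regular (z : L) : Prop := forall P, P <> P0 -> vge P 0 z.

Lemma regularD z w : regular z -> regular w -> regular (z + w).
Proof. by move=> hz hw P PP0; rewrite vgeD ?hz ?hw. Qed.

Lemma regularB z w : regular z -> regular w -> regular (z - w).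
Proof. by move=> hz hw P PP0; rewrite vgeB ?hz ?hw. Qed.

Lemma regularM z w : regular z -> regular w -> regular (z * w).
Proof. by move=> hz hw P PP0; rewrite vge0M ?hz ?hw. Qed.

Lemma regularX z m : regular z -> regular (z ^+ m).
Proof. by move=> hz P PP0; rewrite vge0X ?hz. Qed.

Lemma regularC c : regular (iota c).
Proof. by move=> P PP0; apply: vgeC. Qed.

Lemma regular0 : regular 0.
Proof. by move=> P _; apply: vge0. Qed.

Lemma regular1 : regular 1.
Proof. by move=> P _; apply: vge1. Qed.

Lemma regular_sum (I : Type) (r : seq I) (A : pred I) (f : I -> L) :
  (forall i, A i -> regular (f i)) -> regular (\sum_(i <- r | A i) f i).
Proof. by move=> hf P PP0; apply: vge_sum => i Ai; apply: hf. Qed.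

Lemma regular_prod (I : Type) (r : seq I) (A : pred I) (f : I -> L) :
  (forall i, A i -> regular (f i)) -> regular (\prod_(i <- r | A i) f i).
Proof. by move=> hf P PP0; apply: vge0_prod => i Ai; apply: hf. Qed.

Lemma regular_y : regular y%:A.
Proof. exact: vge0_y. Qed.

Lemma regular_conj (s : gal_of {:L}) z : regular z -> regular (s z).
Proof. by move=> hz P PP0; rewrite -(vge_conj iotaE) hz //;
  apply: conj_place_neq. Qed.

Lemma regular_pval0 z : z != 0 -> regular z -> P0 z <= 0.
Proof.
move=> z0 hz; case: (lerP 0 (P0 z)) => [Pz|/ltW //].
apply: (branch_complete branch) => P; have [->|/eqP] := eqVneq P P0.
  by rewrite vgeE.
exact: hz.
Qed.

Lemma peval_alg h : exists a : K, peval iota h y%:A = a%:A.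
Proof.
elim/poly_ind: h => [|h c [a IHh]]; first by exists 0; rewrite peval0 scale0r.
exists (a * y + kappa c).
by rewrite pevalD pevalM pevalX pevalC IHh iotaE scalerDl algM.
Qed.

Lemma regular_peval h : regular (peval iota h y%:A).
Proof. by move=> P PP0; apply/vge0_peval/vge0_y. Qed.

(** The multiplier is a common denominator, in k[y], of the coefficients of the
    minimal polynomial. *)
Lemma clear_denominator z :
  exists a : K, [/\ a != 0, regular a%:A & regular (a%:A * z)].
Proof.
set p := minPoly 1%AS z.
have [m [sz_p mon_p]] : exists m, size p = m.+1 /\ p`_m = 1.
  exists (size p).-1; have mon_p := monic_minPoly 1%AS z.
  by rewrite prednK ?size_poly_gt0 ?monic_neq0 // -lead_coefE (monicP mon_p).
have /fin_all_exists[h hh] (i : 'I_m) : exists h,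
    peval iota h y%:A != 0 /\ regular (peval iota h y%:A * p`_i).
  have [a ->] := coef_minPoly1 z i; have [h1 [h2 [h2_0 ->]]] := cy a.
  exists h2; split=> //; rewrite mulrC divfK //; exact: regular_peval.
have [a eqa] := peval_alg (\prod_i h i).
have d0 : peval iota (\prod_i h i) y%:A != 0.
  by rewrite peval_prod; apply/prodf_neq0 => i _; case: (hh i).
exists a; split; first by rewrite -(alg_eq0 L) -eqa.
  by rewrite -eqa; apply: regular_peval.
rewrite -eqa; set d := peval _ _ _ in d0 *.
have dp i : regular (d * p`_(val (i : 'I_m))).
  rewrite /d peval_prod (bigD1 i) //= mulrAC; apply: regularM.
    by case: (hh i).
  by apply: regular_prod => j _; apply: regular_peval.
move=> P PP0; have reg_d : vge P 0 d by apply: regular_peval.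
(* Multiplying the minimal equation of z by d^m makes it one for d z. *)
apply: (@integral_vge0 _ _ _ P m
  (fun i => - (d * p`_(val i) * d ^+ (m.-1 - i)))) => [|i]; last first.
  by rewrite vgeN vge0M ?vge0X // dp.
have /rootP := root_minPoly 1%AS z;
  rewrite horner_coef -/p sz_p big_ord_recr /=.
rewrite mon_p mul1r => /eqP; rewrite addrC addr_eq0 => /eqP eqz.
rewrite exprMn eqz mulrN mulr_sumr -sumrN; apply: eq_bigr => i _.
rewrite exprMn mulNr; congr (- _); have lim := ltn_ord i.
have -> : d ^+ m = d * d ^+ (m.-1 - i) * d ^+ i.
  by rewrite -exprS -exprD; congr (_ ^+ _); lia.
ring.
Qed.

(** ** Unramified places *)

(** Away from P0, the field K is dense in L for the P-adic topology, because P
    has a uniformizer in K and residue field k. *)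
Lemma K_dense P (N : int) z : P <> P0 -> exists a : K, vge P N (z - a%:A).
Proof.
move=> PP0; have [/pole_unique //|[c Pc]] := coordinate_center iotaE P cy.
set t := y - kappa c in Pc.
have Pt : P t%:A = 1 by apply: (branch_unramified branch) => //;
  apply: coordinateBC.
have t0 : t%:A != 0 :> L by apply: pval_gt0_neq0 Pc.
have approx n : exists a : K, vge P (P z + n%:Z) (z - a%:A).
  elim: n => [|n [a IHn]]; first exists 0.
    by rewrite scale0r [z - 0]subr0; apply: (@vgeW _ _ _ P _ (P z));
      rewrite ?vge_pval ?addr0.
  set e := P z + n%:Z in IHn; have te : t%:A ^ e != 0 :> L by rewrite
    expfz_neq0.
  have Pte : P (t%:A ^ e) = e by rewrite pvalXz Pt mulr1.
  have : vge P 0 ((z - a%:A) * t%:A ^ (- e)).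
    by rewrite mulrC vgeMl ?expfz_neq0 // pvalXz Pt mulr1 sub0r opprK.
  case/(residue_at cy) => d hd; exists (a + kappa d * t ^ e).
  have -> : z - (a + kappa d * t ^ e)%:A =
      t%:A ^ e * ((z - a%:A) * t%:A ^ (- e) - iota d).
    rewrite scalerDl algM iotaE mulrBr mulrCA -expfzDr // subrr expr0z mulr1.
    rewrite -[t%:A]/(in_alg L t) -rmorphXz ?unitfE; last first.
      by rewrite -(alg_eq0 L).
    by rewrite /= opprD addrA [_ * (kappa d)%:A]mulrC.
  by rewrite vgeMl // Pte; apply: vgeW hd; rewrite /e; lia.
have [a ha] := approx `|N - P z|%N; exists a; apply: vgeW ha; lia.
Qed.

(** As K is dense, an automorphism preserving an unramified place is continuous
    and trivial on a dense subfield. *)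
Lemma decomposition_trivial P (s : gal_of {:L}) :
  P <> P0 -> (forall z, P (s z) = P z) -> s = 1%g.
Proof.
move=> PP0 Ps; apply/eqP/gal_eqP => z _; rewrite gal_id.
apply/eqP; rewrite -subr_eq0; apply/negPn/negP => nz.
have cP : conj_place iotaE P s = P by apply: eq_place => w; apply: Ps.
have small N : vge P N (s z - z).
  have [a ha] := K_dense N z PP0.
  have -> : s z - z = s (z - a%:A) - (z - a%:A).
    by rewrite rmorphB /= gal_alg opprB addrA subrK.
  by rewrite vgeB // -(vge_conj iotaE) cP.
by have := small (P (s z - z) + 1); rewrite vgeE //; lia.
Qed.

End OneBranchPoint.
(** * The fibres away from the ramified place *)

Section Fibre.

Variables (k : closedFieldType) (K : fieldType) (L : splittingFieldType K).
Variables (kappa : {rmorphism k -> K}) (iota : {rmorphism k -> L}).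
Hypothesis iotaE : forall c, iota c = (kappa c)%:A.
Variables (y : K) (P0 : place iota).
Hypothesis branch : one_branch_point y P0.
Implicit Types (P : place iota) (z w : L).

Local Notation Tr := (galTrace 1%AS {:L}%AS).
Local Notation conj := (conj_place iotaE).
Local Notation regular := (regular P0).

Let cy := branch_coordinate branch.

Local Notation above c P := (0 < P (y - kappa c)%:A).

Lemma above_ex P : P <> P0 -> exists c, above c P.
Proof.
by move=> PP0; have [/(pole_unique branch)|] := coordinate_center iotaE P cy.
Qed.

Lemma above_neq P c : above c P -> P <> P0.
Proof.
move=> Pc PP0; move: Pc; rewrite PP0 (algBC iotaE) => Pc.
have : vge P0 0 (y%:A - iota c + iota c).
  by rewrite vgeD ?vgeC // /vge ltW ?orbT.
rewrite subrK vgeE ?(y_neq0 branch) // (branch_pole branch).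
by have := q_gt0 L; lia.
Qed.

Section OneFibre.

Variable c : k.

Local Notation t := (y - kappa c).
Local Notation above P := (0 < P t%:A).

Lemma coord_t : coordinate iota t. Proof. exact: coordinateBC. Qed.

Lemma pval_t P : above P -> P t%:A = 1.
Proof.
by move=> Pc; apply: (branch_unramified branch (above_neq Pc) coord_t).
Qed.

Lemma t_neq0 P : above P -> t%:A != 0 :> L.
Proof. exact: pval_gt0_neq0. Qed.

Lemma regular_t : regular t%:A.
Proof.
rewrite (algBC iotaE); apply: regularB (@regularC _ _ _ _ _ _).
exact: (regular_y branch).
Qed.

Lemma above_conj P s : above P -> above (conj P s).
Proof. by rewrite conj_placeE gal_alg. Qed.

Lemma pval_above P P' (a : K) : above P -> above P' -> P a%:A = P' a%:A.
Proof.
move=> Pc P'c; have [->|a0] := eqVneq a 0; first by rewrite scale0r !pval0.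
have a0' : a%:A != 0 :> L by rewrite alg_eq0.
have [j hj] := rational_pval (coord_t a) a0'.
by rewrite (hj P Pc) (hj P' P'c) (pval_t Pc) (pval_t P'c).
Qed.

(** At the places where t vanishes b / t is integral: its conjugates are regular
    at P, hence so are the coefficients of its minimal polynomial. *)
Lemma regular_div_t P b : above P -> regular b ->
  (forall s : gal_of {:L}, vge P 1 (s b)) -> regular (b / t%:A).
Proof.
move=> Pc reg_b b_ge1 P' P'P0; have t0 := t_neq0 Pc.
have [P't|P'c] := leP (P' t%:A) 0.
  rewrite mulrC vgeMl ?invr_eq0 // pvalV; apply: vgeW (reg_b P' P'P0).
  by rewrite sub0r opprK.
apply: (integral_conj (branch_galois branch) (P := P)) => [a|s].
  have [->|a0] := eqVneq a 0; first by rewrite scale0r !vge0.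
  by rewrite !vgeE ?alg_eq0 // (pval_above a Pc P'c).
rewrite rmorphM fmorphV /= gal_alg mulrC vgeMl ?invr_eq0 // pvalV (pval_t Pc)
  sub0r opprK.
exact: b_ge1.
Qed.

(** If some regular f, not vanishing at P', makes a f / t regular for each
    regular a vanishing at P, then dividing repeatedly shows that a regular
    function vanishes at P' at least as much as at P, so that P and P' are the
    same place. *)
Lemma eq_place_division P P' f : above P -> above P' ->
    regular f -> f != 0 -> P' f = 0 ->
    (forall a, regular a -> vge P 1 a -> regular (a * f / t%:A)) ->
  P = P'.
Proof.
move=> Pc P'c reg_f f0 P'f div; have t0 := t_neq0 Pc.
have le_val n a : regular a -> vge P n%:Z a -> vge P' n%:Z a.
  elim: n a => [|n IHn] a reg_a an; first exact: reg_a _ (above_neq P'c).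
  have a1 : vge P 1 a by apply: vgeW an; lia.
  have := IHn _ (div a reg_a a1); rewrite -mulrA.
  rewrite ![a * _]mulrC !vgeMl ?mulf_neq0 ?invr_eq0 //.
  rewrite !pvalM ?invr_eq0 // !pvalV (pval_t Pc) (pval_t P'c) P'f => IH.
  have : vge P' (n%:Z - (0 + -1)) a.
    apply: IH; apply: vgeW an.
    have : 0 <= P f by rewrite -vgeE //; apply: reg_f (above_neq Pc).
    lia.
  by apply: vgeW; lia.
apply: place_eq_of_sub => z z0 Pz.
have [a [a0 reg_a reg_az]] := clear_denominator iotaE branch z.
have a0' : a%:A != 0 :> L by rewrite alg_eq0.
have Pa : 0 <= P a%:A by rewrite -vgeE //; apply: reg_a (above_neq Pc).
have := le_val (absz (P (a%:A * z))) _ reg_az.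
rewrite pvalM // gez0_abs ?addr_ge0 // !vgeE ?mulf_neq0 // !pvalM // lexx.
by rewrite (pval_above a Pc P'c) lerD2l => /(_ isT); apply: le_trans.
Qed.

(** Places conjugate under distinct automorphisms are distinct, since the
    decomposition groups are trivial; here they are separated by a regular
    function. *)
Lemma separate P : above P -> exists f, [/\ regular f, f != 0, P f = 0 &
  forall s : gal_of {:L}, s != 1%g -> vge P 1 (s f)].
Proof.
move=> Pc; have PP0 := above_neq Pc.
(* The automorphisms s for which regular functions have the same residues at P
   and at its conjugate by s; g separates P from its other conjugates. *)
pose fixes (s : gal_of {:L}) :=
  `[< forall a, regular a -> vge P 1 a -> vge P 1 (s a) >].
have /fin_all_exists[f hf] (s : gal_of {:L}) : exists f,
    [/\ regular f, f != 0, P f = 0 & ~~ fixes s -> vge P 1 (s f)].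
  have [_|nfix] := boolP (fixes s).
    by exists 1; split; rewrite ?oner_eq0 ?pval1 //; apply: regular1.
  have /asboolPn/existsNP[a /not_implyP[reg_a /not_implyP[a1 /negP sa]]] :=
    nfix.
  have [d hd] := residue_at iotaE cy (regular_conj iotaE branch s reg_a PP0).
  have d0 : d != 0.
    by apply: contraNneq sa => d0; move: hd; rewrite d0 rmorph0 subr0.
  have [nz Pa] : a - iota d != 0 /\ P (a - iota d) = 0.
    apply: (@pval_peval_unit _ _ _ P (- d)); first by rewrite oppr_eq0.
    by rewrite rmorphN opprK subrK.
  exists (a - iota d); split=> // [|_].
    by apply: regularB => //; apply: regularC.
  by rewrite rmorphB /= iotaE gal_alg -iotaE.
pose g := \prod_(s | ~~ fixes s) f s.
have reg_g : regular g by apply: regular_prod => s _; case: (hf s).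
have g0 : g != 0 by apply/prodf_neq0 => s _; case: (hf s).
have Pg : P g = 0 by apply: pval_prod0 => s _; case: (hf s).
have g_move s : ~~ fixes s -> vge P 1 (s g).
  move=> nfix; have [reg_f _ _ /(_ nfix) fs] := hf s.
  rewrite /g (bigD1 s) //= rmorphM -[1]addr0 vgeM //.
  apply: (regular_conj iotaE branch) => //; apply: regular_prod => r _.
  by case: (hf r).
suff fix1 s : fixes s -> s = 1%g.
  exists g; split=> // s s1; apply: g_move.
  by apply: contra s1 => /fix1->.
move=> fix_s; apply: (decomposition_trivial iotaE branch PP0).
suff eqP : P = conj P s by move=> z; rewrite -(conj_placeE iotaE) -eqP.
apply: (eq_place_division Pc (above_conj s Pc) reg_g g0).
  have g_ge0 : vge P 0 g by apply: reg_g.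
  have [d hd] := residue_at iotaE cy g_ge0.
  have d0 : d != 0.
    apply: contra_eq_neq Pg => d0; move: hd; rewrite d0 rmorph0 subr0 vgeE //.
    by lia.
  have : vge P 1 (s (g - iota d)).
    have /asboolP := fix_s; apply=> //; apply: regularB => //; exact: regularC.
  by rewrite rmorphB /= iotaE gal_alg -iotaE => /(pval_peval_unit d0)[].
move=> a reg_a a1; apply: (regular_div_t Pc); first exact: regularM.
move=> r; rewrite rmorphM; have [fix_r|nfix] := boolP (fixes r).
  rewrite -[1]addr0 vgeM //; first by have /asboolP := fix_r; apply.
  exact: (regular_conj iotaE branch).
rewrite -[1]add0r vgeM ?g_move //; exact: (regular_conj iotaE branch).
Qed.

(** The Galois group is transitive on each fibre: otherwise the function
    separating P from its conjugates would have a conjugate that does not vanish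
    at P', since its trace does not. *)
Lemma conj_transitive P P' : above P -> above P' -> exists s, P' = conj P s.
Proof.
move=> Pc P'c; have [f [reg_f f0 Pf f_move]] := separate Pc.
have PTr : P (Tr f) = 0.
  rewrite trE (bigD1 1%g) ?gal_all //= gal_id -Pf.
  case: (@pvalDl _ _ _ P f (\sum_(s in 'Gal({:L}%AS / 1%AS)%g | s != 1%g) s f))
    => //.
  by apply: vge_sum => s /andP[_ s1]; rewrite Pf add0r f_move.
have Tr0 : Tr f != 0.
  rewrite trE (bigD1 1%g) ?gal_all //= gal_id.
  case: (@pvalDl _ _ _ P f (\sum_(s in 'Gal({:L}%AS / 1%AS)%g | s != 1%g) s f))
    => //.
  by apply: vge_sum => s /andP[_ s1]; rewrite Pf add0r f_move.
have [s P's] : exists s : gal_of {:L}, ~~ vge P' 1 (s f).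
  apply: contrapT => no_s; have : vge P' 1 (Tr f).
    apply: vge_sum => s _; apply/negPn/negP => h; apply: no_s; by exists s.
  move: PTr Tr0; have [a ->] := tr_alg (branch_galois branch) f.
  by rewrite (pval_above a Pc P'c) => PTr Tr0; rewrite vgeE // PTr.
have P'sf : conj P' s f = 0.
  move: P's; have := regular_conj iotaE branch s reg_f (above_neq P'c).
  by rewrite conj_placeE !vgeE ?gal_eq0 //; lia.
have eqP : P = conj P' s.
  apply: (eq_place_division Pc (above_conj s P'c) reg_f f0 P'sf).
  move=> a reg_a a1; apply: (regular_div_t Pc); first exact: regularM.
  move=> r; rewrite rmorphM /=; have [->|r1] := eqVneq r 1%g.
    by rewrite !gal_id -[1]addr0 vgeM // reg_f //; apply: above_neq Pc.
  rewrite -[1]add0r vgeM ?f_move //.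
  by apply: (regular_conj iotaE branch) => //; apply: above_neq Pc.
exists s^-1%g; apply: eq_place => z.
by rewrite conj_placeE eqP conj_placeE galK_app.
Qed.

End OneFibre.

(** Such functions are the powers of f / t, for f separating P from its
    conjugates and t a parameter at the point below P. *)
Lemma single_pole P (j : nat) : P <> P0 ->
  exists f, [/\ f != 0, P f = - j%:Z &
    forall P', P' <> P0 -> P' <> P -> vge P' 0 f].
Proof.
move=> /above_ex[c Pc]; have [f [reg_f f0 Pf f_move]] := separate Pc.
have t0 := t_neq0 Pc; set t := (y - kappa c)%:A in Pc t0 *.
exists ((f / t) ^+ j); split.
- by rewrite expf_neq0 // mulf_neq0 // invr_eq0.
- by rewrite pvalX pvalM ?invr_eq0 // pvalV Pf (pval_t Pc) add0r mulrN1.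
move=> P' P'P0 P'P; apply: vge0X.
have [P't|P'c] := leP (P' t) 0.
  rewrite mulrC vgeMl ?invr_eq0 // pvalV; apply: vgeW (reg_f P' P'P0).
  by rewrite sub0r opprK.
have [s eqP'] := conj_transitive Pc P'c.
rewrite mulrC vgeMl ?invr_eq0 // pvalV (pval_t P'c) sub0r opprK eqP' vge_conj.
apply: f_move; apply/eqP => s1; apply: P'P; rewrite eqP' s1.
by apply: eq_place => z; rewrite conj_placeE gal_id.
Qed.

(** The trace form on regular functions is unimodular, the cover being
    unramified away from P0.  If z has a pole of order m at P, some regular w
    has order m - 1 at P and a high order at the other conjugates of P, so that
    the trace of z w has a simple pole at P. *)
Lemma regular_dual z :
  (forall w, regular w -> regular (Tr (z * w))) -> regular z.
Proof.
move=> dual P PP0; have [//|zP] := boolP (vge P 0 z).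
have [c Pc] := above_ex PP0; have [f [reg_f f0 Pf f_move]] := separate Pc.
have t0 := t_neq0 Pc; set t := (y - kappa c)%:A in Pc t0.
have z0 : z != 0 by apply: contraNneq zP => ->; apply: vge0.
have {}zP : P z < 0 by move: zP; rewrite vgeE // ltNge.
(* M bounds the orders of the poles of z at the conjugates of P. *)
pose m := (`|P z|%N).-1; pose M := (\sum_(s : gal_of {:L}) `|P (s z)|)%N.
pose w := f ^+ M * t ^+ m.
have reg_w : regular w.
  by apply: regularM; apply: regularX => //; apply: regular_t.
have w0 : w != 0 by rewrite mulf_neq0 ?expf_neq0.
have Pzw : P (z * w) = -1.
  rewrite pvalM // pvalM ?expf_neq0 // !pvalX Pf (pval_t Pc) mulr0 mulr1 add0r
    /m.
  by move: zP; lia.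
have /(_ P PP0) := dual w reg_w.
have zw0 : z * w != 0 by rewrite mulf_neq0.
rewrite trE (bigD1 1%g) ?gal_all //= gal_id.
case: (@pvalDl _ _ _ P (z * w)
         (\sum_(s in 'Gal({:L}%AS / 1%AS)%g | s != 1%g) s (z * w))) => //;
           last first.
  by move=> nz; rewrite vgeE // => ->; rewrite Pzw.
apply: vge_sum => s /andP[_ s1]; rewrite Pzw addNr rmorphM /= vgeMl ?gal_eq0 //.
rewrite /w rmorphM !rmorphXn /= gal_alg -[X in vge P X]addr0 vgeM //;
  last first.
  by rewrite vge0X // /vge ltW ?orbT.
have sf0 : s f != 0 by rewrite gal_eq0.
have := f_move s s1; rewrite !vgeE ?expf_neq0 // pvalX.
have : (`|P (s z)| <= M)%N by rewrite /M (bigD1 s) //= leq_addr.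
by move: (P (s z)) (P (s f)) => v v'; nia.
Qed.

End Fibre.
(** * Self-duality of the ring of regular functions *)

Section Duality.

Variables (k : closedFieldType) (K : fieldType) (L : splittingFieldType K).
Variables (kappa : {rmorphism k -> K}) (iota : {rmorphism k -> L}).
Hypothesis iotaE : forall c, iota c = (kappa c)%:A.
Variables (y : K) (P0 : place iota).
Hypothesis branch : one_branch_point y P0.
Implicit Types (P : place iota) (z w f : L).

Local Notation Tr := (galTrace 1%AS {:L}%AS).
Local Notation regular := (regular P0).
Local Notation q := (\dim {:L}).

Let cy := branch_coordinate branch.
Let total := branch_total branch.
Let y0 := y_neq0 branch.

Definition pole_number (m : int) : Prop :=
  exists f, [/\ f != 0, regular f & P0 f = - m].

Lemma pole_number_ge0 m : pole_number m -> 0 <= m.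
Proof.
by move=> [f [f0 reg_f Pf]]; have := regular_pval0 branch f0 reg_f;
   rewrite Pf oppr_le0.
Qed.

Lemma pole_number0 : pole_number 0.
Proof. by exists 1; split; rewrite ?oner_eq0 ?pval1 //; apply: regular1. Qed.

Lemma pole_numberD m n : pole_number m -> pole_number n -> pole_number (m + n).
Proof.
move=> [f [f0 reg_f Pf]] [g [g0 reg_g Pg]]; exists (f * g); split.
- by rewrite mulf_neq0.
- exact: regularM.
- by rewrite pvalM // Pf Pg opprD.
Qed.

Lemma pval_y : P0 y%:A = - q%:Z. Proof. exact: branch_pole. Qed.

Lemma regular_gt0_eq0 z : regular z -> vge P0 1 z -> z = 0.
Proof.
move=> reg_z; have [//|z0] := eqVneq z 0; rewrite vgeE // => Pz.
by have := regular_pval0 branch z0 reg_z; lia.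
Qed.

Lemma regular_trace z : regular z -> regular (Tr z).
Proof. by move=> reg_z; apply: regular_sum => s _;
  apply: (regular_conj iotaE branch). Qed.

(** ** A basis of minimal pole orders *)

Lemma residue_class z : z != 0 -> exists (i : 'I_q) (j : int), P0 z = i%:Z +
  q%:Z * j.
Proof.
move=> z0; have q0 : q%:Z != 0 by have := q_gt0 L; lia.
have lt_r : (absz (P0 z %% q)%Z < q)%N.
  by rewrite -ltz_nat gez0_abs ?modz_ge0 // ltz_pmod ?ltz_nat ?q_gt0.
exists (Ordinal lt_r), (P0 z %/ q)%Z => /=; rewrite gez0_abs ?modz_ge0 //.
by rewrite {1}(divz_eq (P0 z) q) addrC mulrC.
Qed.

(** The pole orders of these functions form the Apery set, with respect to q, of
    the semigroup of pole numbers at P0. *)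
Lemma minimal_generators : exists f : 'I_q -> L,
  [/\ forall i, f i != 0, forall i, regular (f i),
      forall i : 'I_q, exists j : int, P0 (f i) = i%:Z + q%:Z * j
    & forall (i : 'I_q) g (j : int), g != 0 -> regular g -> P0 g = i%:Z + q%:Z
      * j ->
        P0 g <= P0 (f i)].
Proof.
suff /fin_all_exists[f hf] (i : 'I_q) : exists f, [/\ f != 0, regular f,
    exists j : int, P0 f = i%:Z + q%:Z * j
  & forall g (j : int), g != 0 -> regular g -> P0 g = i%:Z + q%:Z * j ->
    P0 g <= P0 f].
  by exists f; split=> i; case: (hf i).
have [s s0 Ps] := pval_surj P0.
have [a [a0 reg_a reg_as]] := clear_denominator iotaE branch (s ^+ i).
have si0 : s ^+ i != 0 by rewrite expf_neq0.
have a0' : a%:A != 0 :> L by rewrite alg_eq0.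
pose good (n : nat) := `[< exists f, [/\ f != 0, regular f,
  exists j : int, P0 f = i%:Z + q%:Z * j & P0 f = - n%:Z] >].
have goodP g (j : int) : g != 0 -> regular g -> P0 g = i%:Z + q%:Z * j ->
    exists2 n : nat, good n & P0 g = - n%:Z.
  move=> g0 reg_g Pg; have Pg0 := regular_pval0 branch g0 reg_g.
  exists (absz (P0 g)); last by rewrite lez0_abs // opprK.
  by apply/asboolP; exists g; split=> //; [exists j|rewrite lez0_abs // opprK].
have [j Pa] := total a.
have [|||n0 good0 _] := goodP (a%:A * s ^+ i) j => //.
- by rewrite mulf_neq0.
- by rewrite pvalM // Pa pvalX Ps mulr1 addrC.
have [n /asboolP[f [f0 reg_f Pfj Pf]] min_n] := ex_minnP (ex_intro good n0
  good0).
exists f; split=> // g l g0 reg_g Pg;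
  have [m good_m ->] := goodP g l g0 reg_g Pg.
by rewrite Pf lerN2 lez_nat min_n.
Qed.

Section DualBasis.

Variable f : 'I_q -> L.
Hypothesis f0 : forall i, f i != 0.
Hypothesis reg_f : forall i, regular (f i).
Hypothesis f_class : forall i : 'I_q, exists j : int, P0 (f i) = i%:Z + q%:Z *
  j.
Hypothesis f_min : forall (i : 'I_q) g (j : int),
  g != 0 -> regular g -> P0 g = i%:Z + q%:Z * j -> P0 g <= P0 (f i).

Lemma f_mod i j (m : int) : P0 (f i) = P0 (f j) + q%:Z * m -> i = j.
Proof.
have [[a ->] [b ->]] := (f_class i, f_class j) => eqij.
apply: val_inj; apply: (@mod_inj q i j (b + m - a)) => //.
have -> : q%:Z * (b + m - a) = q%:Z * b + q%:Z * m - q%:Z * a by ring.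
lia.
Qed.

(** Subtracting multiples of the y^l f_i lowers the pole order of a regular
    function until nothing remains: the f_i generate the regular functions over
    the constants and y. *)
Lemma regular_coord w : regular w ->
  exists2 c : 'I_q -> K, w = \sum_i c i *: f i & forall i, regular (c i)%:A.
Proof.
have [n le_n] : exists n : nat, vge P0 (1 - n%:Z) w.
  have [->|w0] := eqVneq w 0; first by exists 0; apply: vge0.
  by exists (absz (1 - P0 w)); rewrite vgeE //; lia.
elim: n w le_n => [|n IHn] w w_n reg_w.
  exists (fun=> 0) => [|i]; last by rewrite scale0r; apply: regular0.
  rewrite big1 => [|i _]; last by rewrite scale0r.
  by apply: regular_gt0_eq0 => //; apply: vgeW w_n; lia.
have [small|big] := boolP (vge P0 (1 - n%:Z) w); first exact: IHn.
have w0 : w != 0 by apply: contraNneq big => ->; apply: vge0.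
have [i [j Pw]] := residue_class w0; have [l Pfi] := f_class i.
have le_wf := f_min w0 reg_w Pw.
have q0 := q_gt0 L.
have lj : 0 <= l - j.
  by rewrite -(pmulr_rge0 _ (_ : 0 < q%:Z)) ?ltz_nat //; move: le_wf;
    rewrite Pw Pfi mulrBr; lia.
pose m := absz (l - j); pose g := y%:A ^+ m * f i.
have g0 : g != 0 by rewrite mulf_neq0 ?expf_neq0.
have Pg : P0 g = P0 w.
  by rewrite pvalM ?expf_neq0 // pvalX pval_y Pfi Pw gez0_abs //; ring.
have reg_g : regular g.
  by apply: regularM => //; apply: regularX; apply: (regular_y branch).
have : vge P0 0 (g^-1 * w) by rewrite vgeMl ?invr_eq0 // pvalV Pg sub0r opprK
  vge_pval.
case/(residue_at iotaE cy) => c hc.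
have [||d eqd reg_d] := IHn (w - iota c * g).
- have -> : w - iota c * g = g * (g^-1 * w - iota c).
    by rewrite mulrBr mulVKf // [g * _]mulrC.
  rewrite vgeMl // Pg; apply: vgeW hc.
  by move: w_n big; rewrite !vgeE //; lia.
- by apply: regularB => //; apply: regularM => //; apply: regularC.
exists (fun r => d r + (if r == i then kappa c * y ^+ m else 0)) => [|r].
  under eq_bigr do rewrite scalerDl.
  rewrite big_split /= -eqd [X in _ + X](bigD1 i) //= eqxx.
  rewrite big1 => [|r /negPf->]; last by rewrite scale0r.
  rewrite addr0 -mulr_algl algM -iotaE /g -[t in _ * t * _]/(in_alg L _)
    rmorphXn.
  by rewrite /= mulrA subrK.
rewrite scalerDl; apply: regularD => //; case: eqP => _; last first.
  by rewrite scale0r; apply: regular0.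
rewrite algM -iotaE -[t in _ * t]/(in_alg L _) rmorphXn; apply: regularM.
  exact: regularC.
by apply: regularX; apply: (regular_y branch).
Qed.

Variable delta : nat.

(** The complementary module at P0 is the fractional ideal of z with
    v(z) >= - delta. *)
Hypothesis different : forall z,
  (forall w, vge P0 0 w -> vge P0 0 (Tr (z * w))) <-> vge P0 (- delta%:Z) z.

Lemma trace_vge0 z : vge P0 (- delta%:Z) z -> vge P0 0 (Tr z).
Proof. by move/(different z)/(_ 1 (vge1 P0)); rewrite mulr1. Qed.

Lemma trace_not_vge0 z : P0 z = - delta%:Z - 1 -> ~~ vge P0 0 (Tr z).
Proof.
move=> Pz; have z0 : z != 0.
  by apply: contra_eq_neq Pz => ->; rewrite pval0; lia.
have [x Px nTrx] : exists2 x, P0 x = - delta%:Z - 1 & ~~ vge P0 0 (Tr x).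
  have /existsNP[w /not_implyP[w_ge0 /negP nTr]] :
      ~ (forall w, vge P0 0 w -> vge P0 0 (Tr (z * w))).
    by move/(different z); rewrite vgeE // Pz; lia.
  exists (z * w) => //; have := contraNN (@trace_vge0 _) nTr.
  have zw0 : z * w != 0.
    by apply: contraNneq nTr => ->; rewrite raddf0 vge0.
  have w0 : w != 0 by apply: contraNneq zw0 => ->; rewrite mulr0.
  by move: w_ge0; rewrite !vgeE // pvalM // Pz; lia.
have x0 : x != 0 by apply: contraNneq nTrx => ->; rewrite raddf0 vge0.
have : vge P0 0 (z^-1 * x).
  by rewrite vgeMl ?invr_eq0 // vgeE // pvalV Pz Px; lia.
case/(residue_at iotaE cy) => c hc; apply: contra nTrx => Trz.
have -> : x = (kappa c)%:A * z + z * (z^-1 * x - iota c).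
  by rewrite -iotaE mulrBr mulVKf // [z * iota c]mulrC subrKC.
rewrite raddfD /= tr_algM -iotaE vgeD ?vge0M ?vgeC // trace_vge0 // vgeMl //.
by apply: vgeW hc; rewrite Pz; lia.
Qed.

Lemma trace_nondegenerate z : (forall w, Tr (z * w) = 0) -> z = 0.
Proof.
move=> Trz; apply/eqP/negPn/negP => z0; have [s s0 Ps] := pval_surj P0.
have := @trace_not_vge0 (s ^ (- delta%:Z - 1)).
rewrite pvalXz Ps mulr1 => /(_ erefl); rewrite -[s ^ _](mulKf (invr_neq0 z0)).
by rewrite invrK Trz vge0.
Qed.

(** The Gram matrix of the trace form is invertible, since some element has a
    nonzero trace. *)
Lemma dual_basis : exists f' : 'I_q -> L,
  forall i j, Tr (f' i * f j) = (i == j)%:R.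
Proof.
pose M := \matrix_(i < q, j < q) projT1 (cid (tr_alg (branch_galois branch) (f
  i * f j))).
have ME i j : (M i j)%:A = Tr (f i * f j) by rewrite mxE; case: cid.
have comb (c : 'I_q -> K) z : Tr ((\sum_i c i *: f i) * z) =
    \sum_i (c i)%:A * Tr (f i * z).
  rewrite mulr_suml raddf_sum /=; apply: eq_bigr => i _.
  by rewrite -[c i *: f i]mulr_algl -mulrA tr_algM.
have unitM : M \in unitmx.
  rewrite -row_free_unit; apply: inj_row_free => v vM.
  have z0 : \sum_i v 0 i *: f i = 0.
    apply: trace_nondegenerate => w.
    have [c ->] := adapted_coord total f0 f_mod w;
      rewrite mulrC comb big1 // => j _.
    rewrite [f j * _]mulrC comb.
    have /matrixP/(_ 0 j) : v *m M = 0 by [].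
    rewrite !mxE => /(congr1 (fun a => a%:A : L));
      rewrite scale0r scaler_suml => eq0.
    rewrite [X in _ * X](_ : _ = 0) ?mulr0 // -[RHS]eq0; apply: eq_bigr => i _.
    by rewrite algM ME.
  apply/rowP => i; rewrite mxE; apply/eqP/negPn/negP => vi.
  by have [] := adapted_pval total f0 f_mod vi; rewrite z0 eqxx.
exists (fun i => \sum_j invmx M i j *: f j) => i j; rewrite comb.
transitivity (((invmx M *m M) i j)%:A : L).
  by rewrite mxE scaler_suml; apply: eq_bigr => l _; rewrite algM ME.
by rewrite mulVmx // mxE; case: (i == j); rewrite ?scale1r ?scale0r.
Qed.

(** The dual basis is again made of regular functions, by unimodularity of the
    trace form; its pole orders are read off from the different exponent. *)
Lemma dual_basis_regular (f' : 'I_q -> L) i :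
    (forall i j, Tr (f' i * f j) = (i == j)%:R) ->
  [/\ f' i != 0, regular (f' i)
    & P0 (f' i) = q%:Z - 1 - delta%:Z - P0 (f i)].
Proof.
move=> dual; set z := f' i.
have Tr_comb (c : 'I_q -> K) : Tr (z * \sum_j c j *: f j) = (c i)%:A.
  rewrite mulr_sumr raddf_sum /= (bigD1 i) //= big1 => [|j ji].
    by rewrite -[c i *: f i]mulr_algl mulrCA tr_algM dual eqxx mulr1 addr0.
  by rewrite -[c j *: f j]mulr_algl mulrCA tr_algM dual eq_sym (negPf ji) mulr0.
have z0 : z != 0.
  apply/eqP => z0; have := dual i i; rewrite -/z z0 mul0r raddf0 eqxx => /eqP.
  by rewrite eq_sym oner_eq0.
split=> //.
  apply: (regular_dual iotaE branch) => w reg_w.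
  by have [c -> reg_c] := regular_coord reg_w; rewrite Tr_comb.
have [s s0 Ps] := pval_surj P0; have q0 := q_gt0 L.
apply/eqP; rewrite eq_le; apply/andP; split.
  (* Otherwise the trace of z y f_i, which is y, would be regular at P0. *)
  rewrite leNgt; apply/negP => big; have : vge P0 0 (Tr (z * (y%:A * f i))).
    by apply: trace_vge0; rewrite vgeE ?mulf_neq0 // !pvalM ?mulf_neq0 //
      pval_y; lia.
  by rewrite mulrCA tr_algM dual eqxx mulr1 vgeE // pval_y; lia.
(* On the functions e w of valuation at least v(f_i) - (q - 1), the i-th
   coordinate, which is the trace against z, takes values regular at P0. *)
pose e := s ^ (P0 (f i) - (q%:Z - 1)).
have e0 : e != 0 by rewrite expfz_neq0.
have Pe : P0 e = P0 (f i) - (q%:Z - 1) by rewrite pvalXz Ps mulr1.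
have : vge P0 (- delta%:Z) (e * z); last by rewrite vgeMl // vgeE // Pe; lia.
apply/different => w w_ge0; rewrite [e * z]mulrC -mulrA.
have [c eq_c] := adapted_coord total f0 f_mod (e * w); rewrite eq_c Tr_comb.
have [->|ci] := eqVneq (c i) 0; first by rewrite scale0r vge0.
have [nz] := adapted_pval total f0 f_mod ci; rewrite -eq_c in nz *.
have w0 : w != 0 by apply: contraNneq nz => ->; rewrite mulr0.
rewrite vgeE ?alg_eq0 // pvalM // Pe; have [j ->] := total (c i).
move: w_ge0; rewrite vgeE // => w_ge0 le_c; rewrite pmulr_rge0 //.
have : 0 < q%:Z * (j + 1) by rewrite mulrDr mulr1; lia.
by rewrite pmulr_rgt0 ?ltz_nat //; lia.
Qed.

End DualBasis.

(** ** Symmetry of the semigroup of pole numbers *)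

Variable delta : nat.
Hypothesis different : forall z,
  (forall w, vge P0 0 w -> vge P0 0 (Tr (z * w))) <-> vge P0 (- delta%:Z) z.

Local Notation N := (delta%:Z - 2 * q%:Z + 1).

(** The trace of a regular function f with a pole of order N would be regular
    and vanish at P0, hence be zero; but y^2 f has a nonzero trace. *)
Lemma not_pole_number : ~ pole_number N.
Proof.
move=> [f [f0 reg_f Pf]].
have Tr0 : Tr f = 0.
  apply: regular_gt0_eq0; first exact: regular_trace.
  have : vge P0 0 (Tr (y%:A * f)).
    apply: (trace_vge0 different).
    by rewrite vgeE ?mulf_neq0 // pvalM // pval_y Pf; have := q_gt0 L; lia.
  rewrite tr_algM vgeMl // pval_y sub0r opprK; apply: vgeW.
  by have := q_gt0 L; lia.
have : ~~ vge P0 0 (Tr (y%:A * (y%:A * f))).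
  apply: (trace_not_vge0 different).
  by rewrite !pvalM ?mulf_neq0 // pval_y Pf; lia.
by rewrite !tr_algM Tr0 !mulr0 vge0.
Qed.

(** If m is a gap, the minimal generator f_i in the class of m has a pole of
    order m + q l with l > 0, and y^(l-1) times the dual element has a pole of
    order N - m. *)
Lemma gap_pole_number m : ~ pole_number m -> pole_number (N - m).
Proof.
move=> gap_m; have [f [f0 reg_f f_class f_min]] := minimal_generators.
have [f' dual] := dual_basis f0 f_class different.
have [s s0 Ps] := pval_surj P0.
have [i [j]] : exists (i : 'I_q) (j : int), - m = i%:Z + q%:Z * j.
  have sm0 : s ^ (- m) != 0 by rewrite expfz_neq0.
  by have := residue_class sm0; rewrite pvalXz Ps mulr1.
have [f'0 reg_f' Pf'] := dual_basis_regular f0 reg_f f_class f_min different i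
  dual.
have [l Pfi] := f_class i => eq_m.
have ypow e z : z != 0 -> P0 (y%:A ^+ e * z) = P0 z - q%:Z * e%:Z.
  by move=> z0; rewrite pvalM ?expf_neq0 // pvalX pval_y; ring.
have reg_y := regular_y branch.
have [le_jl|lt_lj] := lerP j l.
  case: gap_m; exists (y%:A ^+ absz (l - j)%R * f i); split.
  - by rewrite mulf_neq0 ?expf_neq0.
  - by apply: regularM => //; apply: regularX.
  - by rewrite ypow // gez0_abs ?subr_ge0 // Pfi eq_m; ring.
exists (y%:A ^+ absz (j - l - 1)%R * f' i); split.
- by rewrite mulf_neq0 ?expf_neq0.
- by apply: regularM => //; apply: regularX.
- rewrite ypow // gez0_abs ?subr_ge0; last by lia.
  have -> : m = - (i%:Z + q%:Z * j) by rewrite -eq_m opprK.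
  by rewrite Pf' Pfi; ring.
Qed.

Lemma pole_number_symmetry m : pole_number m <-> ~ pole_number (N - m).
Proof.
split=> [pm pNm|pm].
  by apply: not_pole_number; have := pole_numberD pm pNm; rewrite subrKC.
by apply: contrapT => gap_m; apply/pm/gap_pole_number.
Qed.

End Duality.
(** * Spaces of functions with bounded poles *)

Section BoundedPoles.

Variables (k : closedFieldType) (K : fieldType) (L : splittingFieldType K).
Variables (kappa : {rmorphism k -> K}) (iota : {rmorphism k -> L}).
Hypothesis iotaE : forall c, iota c = (kappa c)%:A.
Implicit Types (P : place iota) (z w f : L) (n : place iota -> int).

(** Riemann-Roch spaces.  A divisor is given by its coefficient function, which
    makes it easy to change one coefficient at a time. *)
Definition RR n f : Prop := forall P, vge P (- n P) f.

Definition dim_ge n (m : nat) : Prop :=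
  exists b : 'I_m -> L, (forall i, RR n (b i)) /\ const_free iota b.

Lemma RR_scale n c f : RR n f -> RR n (iota c * f).
Proof. by move=> hf P; rewrite -[- _]add0r vgeM ?vgeC. Qed.

Lemma RR_sum n (I : Type) (r : seq I) (A : pred I) (c : I -> k) (b : I -> L) :
  (forall i, RR n (b i)) -> RR n (\sum_(i <- r | A i) iota (c i) * b i).
Proof. by move=> hb P; apply: vge_sum => i _; apply: RR_scale. Qed.

Lemma eq_RR n n' f : n =1 n' -> RR n f -> RR n' f.
Proof. by move=> eqn hf P; rewrite -eqn. Qed.

Lemma eq_dim_ge n n' m : n =1 n' -> dim_ge n m -> dim_ge n' m.
Proof.
by move=> eqn [b [hb freeb]]; exists b; split=> // i; apply: eq_RR (hb i).
Qed.

(** A function outside a space is independent of any family inside it. *)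
Lemma dim_ge_grow n n' m f : (forall P, n P <= n' P) ->
  RR n' f -> ~ RR n f -> dim_ge n m -> dim_ge n' m.+1.
Proof.
move=> le_nn' hf nf [b [hb freeb]].
exists (fun i => oapp b f (unlift ord0 i)); split=> [i|c].
  case: unliftP => [j _|_] //= P; apply: vgeW (hb j P); by rewrite lerN2.
rewrite big_ord_recl unlift_none /=.
under eq_bigr => j _ do rewrite liftK /=.
have [c0|c0] := eqVneq (c ord0) 0.
  rewrite c0 rmorph0 mul0r add0r => /freeb hc i.
  by case: (unliftP ord0 i) => [j|] -> //; apply: hc.
move=> /eqP; rewrite addr_eq0 => /eqP eqf; case: nf.
suff -> : f = iota (- (c ord0)^-1) * \sum_(j < m) iota (c (fintype.lift ord0
  j)) * b j.
  by apply: RR_scale; apply: RR_sum.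
have ic0 : iota (c ord0) != 0 by rewrite fmorph_eq0.
by rewrite rmorphN mulNr -mulrN -eqf fmorphV mulKf.
Qed.

(** Lowering one coefficient of the divisor imposes one linear condition, the
    residue field being k. *)
Lemma dim_ge_shrink y n n' P m : coordinate iota y ->
    (forall R, R <> P -> n R = n' R) -> n P = n' P + 1 ->
  dim_ge n m -> dim_ge n' m.-1.
Proof.
move=> cy eqn nP; case: m => [|m] [b [hb freeb]] /=.
  by exists b; split=> // -[].
have [t t0 Pt] := pval_surj P; pose u := t ^ n P.
have u0 : u != 0 by rewrite expfz_neq0.
have Pu : P u = n P by rewrite pvalXz Pt mulr1.
have ub_ge0 i : vge P 0 (u * b i) by rewrite vgeMl // Pu sub0r; apply: hb.
have /fin_all_exists[c hc] i := residue_at iotaE cy (ub_ge0 i).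
(* Any i0 with c i0 <> 0 will do; if all the c i vanish, r is 0. *)
have [i0 [r hr]] : exists i0 (r : 'I_m -> k),
    forall j, c (fintype.lift i0 j) = r j * c i0.
  have [i0 ci0|c0] := pickP (fun i => c i != 0).
    by exists i0, (fun j => c (fintype.lift i0 j) / c i0) => j; rewrite divfK.
  exists ord0, (fun=> 0) => j; rewrite mul0r; apply/eqP.
  by have /negbFE := c0 (fintype.lift ord0 j).
pose b' j := b (fintype.lift i0 j) - iota (r j) * b i0.
exists b'; split=> [j R|d].
  have [->|/eqP RP] := eqVneq R P.
    have -> : - n' P = 1 - P u by rewrite Pu nP; ring.
    rewrite -vgeMl // /b' mulrBr.
    have -> : u * b (fintype.lift i0 j) - u * (iota (r j) * b i0) =
        (u * b (fintype.lift i0 j) - iota (c (fintype.lift i0 j)))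
        - iota (r j) * (u * b i0 - iota (c i0)).
      rewrite hr rmorphM; ring.
    by rewrite vgeB // -[1]add0r vgeM ?vgeC.
  by rewrite -eqn // /b' vgeB ?hb // RR_scale.
move=> sum0; pose e i := if unlift i0 i is Some j then d j else - \sum_j d j *
  r j.
have /freeb e0 : \sum_i iota (e i) * b i = 0.
  rewrite (bigD1_ord i0) //= /e unlift_none -[RHS]sum0 rmorphN rmorph_sum mulNr.
  rewrite mulr_suml -sumrN -big_split /=; apply: eq_bigr => j _.
  by rewrite liftK /b' rmorphM; ring.
by move=> j; have := e0 (fintype.lift i0 j); rewrite /e liftK.
Qed.

(** ** Functions with poles at P0 only *)

Variables (y : K) (P0 : place iota).
Hypothesis branch : one_branch_point y P0.

Let cy := branch_coordinate branch.

Definition at_point (c : int) P : int := if P == P0 then c else 0.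

Lemma RR_at_point c f : RR (at_point c) f <-> regular P0 f /\ vge P0 (- c) f.
Proof.
rewrite /RR /at_point; split=> [hf|[reg_f Pf] P].
  split=> [P /eqP/negPf PP0|]; first by have := hf P; rewrite PP0 oppr0.
  by have := hf P0; rewrite eqxx.
by have [->|/eqP PP0] := eqVneq P P0; rewrite ?oppr0 //; apply: reg_f.
Qed.

Definition is_pole_number (m : nat) : bool := `[< pole_number P0 m%:Z >].

Lemma pole_functions : exists phi : nat -> L, forall m, is_pole_number m ->
  [/\ phi m != 0, regular P0 (phi m) & P0 (phi m) = - m%:Z].
Proof.
have /choice[phi hphi] (m : nat) : exists f, is_pole_number m ->
    [/\ f != 0, regular P0 f & P0 f = - m%:Z].
  have [/asboolP[f hf]|] := boolP (is_pole_number m); first by exists f.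
  by exists 0.
by exists phi.
Qed.

Lemma regular_span (phi : nat -> L) (m : nat) f :
    (forall i, is_pole_number i ->
      [/\ phi i != 0, regular P0 (phi i) & P0 (phi i) = - i%:Z]) ->
    regular P0 f -> vge P0 (1 - m%:Z) f ->
  exists c : nat -> k, f = \sum_(0 <= i < m | is_pole_number i) iota (c i) *
    phi i.
Proof.
move=> hphi; elim: m f => [|m IHm] f reg_f f_ge.
  exists (fun=> 0); rewrite big_geq //.
  exact: (regular_gt0_eq0 branch reg_f f_ge).
have [small|big] := boolP (vge P0 (1 - m%:Z) f).
  have [c ->] := IHm f reg_f small; exists (fun i => if i == m then 0 else c i).
  rewrite [RHS]big_mkcond big_nat_recr //= eqxx rmorph0 mul0r if_same addr0.
  rewrite big_mkcond; apply: eq_big_nat => i /andP[_ lt_im].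
  by rewrite ltn_eqF.
have f0 : f != 0 by apply: contraNneq big => ->; apply: vge0.
have Pf : P0 f = - m%:Z by move: f_ge big; rewrite !vgeE //; lia.
have pole_m : is_pole_number m by apply/asboolP; exists f.
have [phi0 reg_phi Pphi] := hphi m pole_m.
have : vge P0 0 ((phi m)^-1 * f).
  by rewrite vgeMl ?invr_eq0 // pvalV vgeE // Pphi Pf; lia.
case/(residue_at iotaE cy) => d hd.
have eq_f : f - iota d * phi m = phi m * ((phi m)^-1 * f - iota d).
  by rewrite mulrBr mulVKf // [phi m * _]mulrC.
have [||c eqc] := IHm (f - iota d * phi m).
- by apply: regularB => //; apply: regularM => //; apply: regularC.
- by rewrite eq_f vgeMl //; apply: vgeW hd; rewrite Pphi; lia.
exists (fun i => if i == m then d else c i).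
rewrite [RHS]big_mkcond big_nat_recr //= eqxx pole_m.
rewrite -[LHS](subrK (iota d * phi m)) eqc big_mkcond; congr (_ + _).
by apply: eq_big_nat => i /andP[_ lt_im]; rewrite ltn_eqF.
Qed.

(** Choosing one function for each pole number up to a gives a basis: their
    distinct valuations at P0 make them independent, and subtracting multiples
    of them lowers the pole order of any given function until it vanishes. *)
Lemma basis_at_point (a : nat) :
  exists b : 'I_(count is_pole_number (seq.iota 0 a.+1)) -> L,
  [/\ forall i, RR (at_point a%:Z) (b i), const_free iota b
    & forall f, RR (at_point a%:Z) f -> exists c, f = \sum_i iota (c i) * b i].
Proof.
have [phi hphi] := pole_functions.
rewrite -size_filter; set s := filter _ _.
have sP (i : 'I_(size s)) :
    is_pole_number (nth 0%N s i) /\ (nth 0%N s i <= a)%N.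
  have := mem_nth 0%N (ltn_ord i).
  by rewrite mem_filter mem_iota add0n ltnS => /andP[].
exists (fun i => phi (nth 0%N s i)); split=> [i||f].
- have [pole_i le_ia] := sP i; have [phi0 reg_phi Pphi] := hphi _ pole_i.
  by apply/RR_at_point; split=> //; rewrite vgeE // Pphi lerN2.
- apply: (const_free_pval (P := P0)) => [i|i j].
    by have [phi0] := hphi _ (sP i).1.
  have [[_ _ ->] [_ _ ->]] := (hphi _ (sP i).1, hphi _ (sP j).1).
  move/oppr_inj => [] /eqP; rewrite nth_uniq ?filter_uniq ?iota_uniq //.
  by move/eqP/val_inj.
move/RR_at_point=> [reg_f f_ge].
have [|c ->] := @regular_span phi a.+1 f hphi reg_f.
  by apply: vgeW f_ge; lia.
exists (fun i : 'I_(size s) => c (nth 0%N s i)).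
rewrite -big_filter (big_nth 0%N) big_mkord; apply: eq_bigr => i _.
by rewrite -/s.
Qed.

(** ** Counting gaps *)

Variable N : int.
Hypothesis symmetry : forall m, pole_number P0 m <-> ~ pole_number P0 (N - m).

Definition gaps_below (m : nat) : seq nat :=
  [seq i <- seq.iota 0 m | ~~ is_pole_number i].

(** The number of integers in the interval [0, N]; it contains all gaps. *)
Local Notation B := (absz (N + 1)).

Lemma bound_eq : B%:Z = N + 1.
Proof.
have : pole_number P0 (N + 1).
  apply/symmetry; have -> : N - (N + 1) = -1 by ring.
  by move/(pole_number_ge0 branch).
by move/(pole_number_ge0 branch) => N1_ge0; rewrite gez0_abs.
Qed.

Lemma pole_number_rev (i : nat) : (i < B)%N ->
  is_pole_number (B - i.+1) = ~~ is_pole_number i.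
Proof.
move=> lt_iB; have eqi : (B - i.+1)%N%:Z = N - i%:Z.
  by have := bound_eq; lia.
rewrite /is_pole_number eqi; apply/asboolP/idP => [h|].
  by apply/asboolPn => hi; case: (symmetry i) => /(_ hi).
by move/asboolPn => hi; apply: contrapT => h; apply/hi/symmetry.
Qed.

Lemma pole_number_large (i : nat) : (B <= i)%N -> is_pole_number i.
Proof.
move=> le_Bi; apply/asboolP/symmetry => /(pole_number_ge0 branch).
by have := bound_eq; lia.
Qed.

Lemma size_gaps : B = (2 * size (gaps_below B))%N.
Proof.
have sumE (p : pred nat) m : count p (seq.iota 0 m) = (\sum_(i < m) p i)%N.
  have -> : seq.iota 0 m = index_iota 0 m by rewrite /index_iota subn0.
  by rewrite -sum1_count big_mkcond big_mkord; apply: eq_bigr => i _;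
    case: (p i).
have := count_predC is_pole_number (seq.iota 0 B).
rewrite size_iota size_filter => {1}<-.
rewrite mul2n -addnn; congr (_ + _)%N.
rewrite [LHS]sumE [RHS](sumE (fun i => ~~ is_pole_number i)).
rewrite (reindex_inj rev_ord_inj); apply: eq_bigr => i _ /=.
by rewrite pole_number_rev.
Qed.

Lemma count_pole_numbers (m : nat) : (B <= m)%N ->
  (count is_pole_number (seq.iota 0 m) + size (gaps_below B) = m)%N.
Proof.
move=> le_Bm; rewrite size_filter -{1}(subnKC le_Bm) iotaD count_cat add0n.
rewrite addnAC; have := count_predC is_pole_number (seq.iota 0 B).
rewrite size_iota => ->.
have -> : count is_pole_number (seq.iota B (m - B)) = (m - B)%N.
  rewrite -[RHS](size_iota B); apply/eqP; rewrite -all_count.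
  by apply/allP => i; rewrite mem_iota => /andP[/pole_number_large].
exact: subnKC.
Qed.

(** Riemann's inequality for the divisor c P0 + s with c large: each point of s
    raises the dimension by one, thanks to functions with a single pole there.
      *)
Lemma dim_ge_effective (s : seq (place iota)) : exists c0 : nat,
  forall c : nat, (c0 <= c)%N -> exists2 m : nat,
    (c + 1 + size s = m + size (gaps_below B))%N
    & dim_ge (fun P => at_point c%:Z P + (count_mem P s)%:Z) m.
Proof.
elim: s => [|P s [c0 IHs]].
  exists B => c le_Bc; exists (count is_pole_number (seq.iota 0 c.+1)).
    by rewrite count_pole_numbers ?addn0 ?addn1 // ltnW.
  have [b [hb freeb _]] := basis_at_point c.
  by exists b; split=> // i; apply: eq_RR (hb i) => P /=; rewrite addr0.
have [->|/eqP PP0] := eqVneq P P0.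
  exists c0 => c le_c0; have [|m eq_m dim_m] := IHs c.+1; first exact: leqW.
  exists m => /=; first by rewrite -eq_m; lia.
  apply: eq_dim_ge dim_m => R /=; rewrite /at_point [P0 == R]eq_sym.
  by case: eqP => _; lia.
set j := count_mem P s; have [f [f0 Pf reg_f]] := single_pole iotaE branch j.+1
  PP0.
exists (maxn c0 (absz (P0 f))) => c; rewrite geq_max => /andP[le_c0 le_f].
have [m eq_m dim_m] := IHs c le_c0; exists m.+1 => /=;
  first by rewrite addSn -eq_m; lia.
apply: (dim_ge_grow (f := f)) dim_m => [R|R|].
- by rewrite lerD2l lez_nat leq_addl.
- have [->|/eqP RP0] := eqVneq R P0.
    by rewrite vgeE // /at_point eqxx; lia.
  have [<-|/eqP RP] := eqVneq P R.
    by rewrite vgeE // /at_point (introF eqP PP0) -/j Pf; lia.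
  apply: vgeW (reg_f R RP0 (nesym RP)).
  by rewrite /at_point (introF eqP RP0) oppr_le0 add0r.
- move/(_ P); rewrite vgeE // /at_point (introF eqP PP0) -/j Pf; lia.
Qed.

Lemma dim_ge_removes n (s : seq (place iota)) m :
  dim_ge n m -> dim_ge (fun P => n P - (count_mem P s)%:Z) (m - size s).
Proof.
elim: s n m => [|P s IHs] n m dim_m /=.
  by rewrite subn0; apply: eq_dim_ge dim_m => P; rewrite subr0.
rewrite subnS; apply: (dim_ge_shrink (P := P) cy _ _ (IHs n m dim_m)) => [R
  RP|].
  by rewrite (introF eqP (nesym RP)).
by rewrite /= eqxx add1n intS; ring.
Qed.

Lemma riemann_inequality (s1 s2 : seq (place iota)) : exists2 m : nat,
  (size s1 + 1 <= m + size (gaps_below B) + size s2)%N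
  & dim_ge (fun P => (count_mem P s1)%:Z - (count_mem P s2)%:Z) m.
Proof.
have [c /(_ c (leqnn c))[m eq_m dim_m]] := dim_ge_effective s1.
exists (m - size (nseq c P0 ++ s2))%N.
  by rewrite size_cat size_nseq; lia.
apply: eq_dim_ge (dim_ge_removes (nseq c P0 ++ s2) dim_m) => P.
rewrite count_cat count_nseq /= /at_point [P0 == P]eq_sym.
by case: eqP => _; lia.
Qed.

End BoundedPoles.
(** * The rational function field *)

Lemma fraction_ratio (R : idomainType) (a : {fraction R}) :
  exists n d : R, tofrac d != 0 /\ a = tofrac n / tofrac d.
Proof.
elim/quotW: a => r; have d0 := denom_ratioP r.
exists (frac r).1, (frac r).2; split; first by rewrite tofrac_eq0.
apply: (canRL (mulfK _)); first by rewrite tofrac_eq0.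
unlock FracField.tofrac; rewrite -[LHS]FracField.pi_mul; apply/eqmodP.
rewrite /= FracField.equivfE /FracField.mulf /= !numden_Ratio ?oner_eq0 //.
  by rewrite !mulr1 mulrC.
all: by rewrite ?mulr1.
Qed.

Section FunctionField.

Variables (k : closedFieldType) (F : splittingFieldType (ratfun k)).
Implicit Types (P : point F) (z w f : F) (a u : ratfun k).

Local Notation iota := (ff_const F).
Local Notation kappa := (ratfun_const k).
Local Notation Tr := (galTrace 1%AS {:F}%AS).
Local Notation q := (\dim {:F}).

Lemma ff_constE c : iota c = (kappa c)%:A.
Proof. by []. Qed.

Lemma ratfun_rational a : rational_in iota (tofrac 'X)%:A (a%:A : F).
Proof.
have ev h : peval iota h (tofrac 'X)%:A = (tofrac h)%:A :> F.
  elim/poly_ind: h => [|h c IHh]; first by rewrite peval0 rmorph0 scale0r.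
  by rewrite pevalD pevalM pevalX pevalC IHh -algM !rmorphD rmorphM scalerDl.
have [h1 [h2 [h2_0 ->]]] := fraction_ratio a.
by exists h1, h2; rewrite !ev alg_eq0 h2_0 algM algV.
Qed.

Lemma coordinate_at P : exists u, coordinate iota u /\ 0 < P u%:A.
Proof.
have cx : coordinate iota (tofrac 'X) := ratfun_rational.
have [Px|[c Pc]] := coordinate_center ff_constE P cx.
  exists (tofrac 'X)^-1; split; first exact: coordinateV.
  by rewrite algV pvalV oppr_gt0.
by exists (tofrac 'X - kappa c); split=> //; apply: (coordinateBC ff_constE).
Qed.

(** The restriction of a place to k(x), once normalized. *)
Lemma place_below P u : coordinate iota u -> 0 < P u%:A ->
  exists Q : place (kappa), ramification_index P Q `|P u%:A|.
Proof.
move=> cu Pu; have [e def_e] : exists e, P u%:A = e by eexists.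
have e_gt0 : 0 < e by rewrite -def_e.
have alg0 a : a != 0 -> a%:A != 0 :> F by rewrite alg_eq0.
pose v a := (P a%:A %/ e)%Z.
have Pe a : P a%:A = e * v a.
  rewrite /v; have [->|a0] := eqVneq a 0;
    first by rewrite scale0r pval0 div0z mulr0.
  have [j Pj] := rational_pval (cu a) (alg0 a a0).
  have -> : P a%:A = j * e by rewrite -def_e; apply: Pj.
  by rewrite mulzK ?gt_eqF // mulrC.
have v0 : v 0 = 0 by rewrite /v scale0r pval0 div0z.
have vM (y z : ratfun k) : y != 0 -> z != 0 -> v (y * z) = v y + v z.
  move=> /alg0 y0 /alg0 z0; apply: (mulfI (lt0r_neq0 e_gt0)).
  by rewrite mulrDr -!Pe algM pvalM.
have vD (y z : ratfun k) : y != 0 -> z != 0 -> y + z != 0 ->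
    Num.min (v y) (v z) <= v (y + z).
  move=> /alg0 y0 /alg0 z0 /alg0 yz0; rewrite -(ler_pM2l e_gt0) -Pe.
  move: yz0; rewrite scalerDl => yz0; have := pvalD P y0 z0 yz0.
  by rewrite (Pe y) (Pe z) minr_pMr // ltW.
have vC c : v (kappa c) = 0.
  by rewrite /v -ff_constE pvalC div0z.
have v1 : exists2 t, t != 0 & v t = 1.
  exists u; last by rewrite /v def_e divzz gt_eqF.
  apply: contraTneq e_gt0 => u0; rewrite -def_e u0 scale0r pval0.
  by rewrite ltxx.
exists (@Place _ _ (kappa) v v0 vM vD vC v1); split.
  by rewrite def_e absz_gt0 gt_eqF.
by move=> a; rewrite def_e gtz0_abs //= (Pe a).
Qed.

Lemma unramified_pval P u :
  ~ ramified P -> coordinate iota u -> 0 < P u%:A -> P u%:A = 1.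
Proof.
move=> unr cu Pu; have [Q PQ] := place_below cu Pu.
have : ~ (1 < `|P u%:A|)%N by move=> h; apply: unr; exists Q, `|P u%:A|%N.
by move: Pu; lia.
Qed.

(** If the coordinate u vanishes at P, its value generates the value group of
    k(x) at P; so u has a simple zero below P, and 1/u a simple pole. *)
Lemma coordinate_pole P Q e : ramification_index P Q e ->
  exists y, coordinate iota y /\ P y%:A = - e%:Z.
Proof.
move=> [e0 PQ]; have [u [cu Pu]] := coordinate_at P.
exists u^-1; split; first exact: coordinateV.
have [a a0 Qa] := pval_surj Q; have a0' : a%:A != 0 :> F by rewrite alg_eq0.
have [j Pj] := rational_pval (cu a) a0'.
rewrite algV pvalV; congr (- _); have := Pj P Pu; move: Pu.
rewrite !PQ Qa; move: (Q u) => m; clear - e0.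
have : 0 < e%:Z by []; move: e%:Z => E E0 m0 h.
have jm : j * m = 1 by apply: (mulfI (lt0r_neq0 E0)); rewrite h; ring.
have {}m0 : 0 < m by rewrite -(pmulr_rgt0 _ E0).
have j0 : 0 < j by nia.
have -> : m = 1 by nia.
by rewrite mulr1.
Qed.


(** ** From the definitions of places and divisors to valuations *)

Lemma RRspaceP D f : RRspace D f <-> forall P, vge P (- coeff P D) f.
Proof.
split=> [[->|Df] P|Df]; first exact: vge0.
  by rewrite /vge Df orbT.
have [->|f0] := eqVneq f 0; first by left.
by right=> P; rewrite -vgeE.
Qed.

Lemma const_free_RRdim D m n (b : 'I_n -> F) : RRdim D m ->
  (forall i, RRspace D (b i)) -> const_free iota b -> (n <= m)%N.
Proof.
move=> [e [_ _ span]] Db; have /fin_all_exists[C hC] i := span _ (Db i).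
exact: const_free_leq hC.
Qed.

(** A nonconstant function z without poles would make nonzero spaces L(D)
    infinite-dimensional, as they are stable under multiplication by z.  If it
    vanishes at P0, then z L(D + P0) is contained in L(D), so L(D) = 0 implies
    L(D + P0) = 0, and the genus could not be finite. *)
Lemma genus_complete g P0 z :
  genus F g -> (forall P, vge P 0 z) -> P0 z <= 0.
Proof.
move=> [max_g [D [m [dimD eq_g]]]] z_ge0; rewrite leNgt; apply/negP => z_gt0.
have z0 := pval_gt0_neq0 z_gt0.
case: m => [|m] in dimD eq_g.
  suff /max_g : RRdim (D + << P0 >>) 0 by rewrite degD degU; move: eq_g; lia.
  exists (fun=> 0); split=> [[]//|c _ []//|f /RRspaceP Df].
  exists (fun=> 0); rewrite big_ord0.
  have [e [_ _ /(_ (f * z))]] := dimD; case.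
    apply/RRspaceP => P; have := Df P; rewrite coeffD coeffU mul1r.
    have [<-|PP0] := eqVneq P0 P => Pf.
      have -> : - coeff P0 D = - (coeff P0 D + 1) + 1 by ring.
      by rewrite vgeM // vgeE //.
    by rewrite -[- _]addr0 vgeM //; move: Pf; rewrite /= addr0.
  by move=> c /eqP; rewrite big_ord0 mulf_eq0 (negPf z0) orbF => /eqP.
have [b [Db freeb _]] := dimD.
have b0 : b ord0 != 0 := const_free_neq0 ord0 freeb.
pose bz (i : 'I_m.+2) := b ord0 * z ^+ i.
suff : (m.+2 <= m.+1)%N by rewrite ltnn.
apply: (const_free_RRdim (b := bz) dimD) => [i|].
  apply/RRspaceP => P; rewrite -[- _]addr0 vgeM ?vge0X //.
  by have /RRspaceP := Db ord0; apply.
apply: (const_free_pval (P := P0)) => [i|i j].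
  by rewrite mulf_neq0 ?expf_neq0.
rewrite !pvalM ?expf_neq0 // !pvalX => /addrI/(mulIf (lt0r_neq0 z_gt0)) [].
exact: val_inj.
Qed.

Lemma weierstrassP (y : ratfun k) (P0 : point F) (m : nat) :
  one_branch_point y P0 ->
  weierstrass_semigroup P0 m <-> pole_number P0 m%:Z.
Proof.
move=> branch; split=> -[f].
  move=> [f0 Df]; have reg_f : regular P0 f.
    move=> P PP0; have := Df P; rewrite coeffU.
    have -> : (P0 == P) = false by apply/eqP => eqP; apply: PP0.
    by rewrite mulr0 vgeE // => /esym; lia.
  exists f; split=> //; have := Df P0; rewrite coeffU eqxx mulr1.
  by rewrite max_r ?oppr_ge0 ?(regular_pval0 branch) // => ->; rewrite opprK.
move=> [f0 reg_f Pf]; exists f; split=> // P; rewrite coeffU.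
have [<-|/eqP PP0] := eqVneq P0 P; first by rewrite mulr1 Pf opprK max_r.
have := reg_f P (nesym PP0); rewrite mulr0 vgeE // => Pf_ge0.
by rewrite max_l // oppr_le0.
Qed.

Section Branch.

Hypothesis gal_F : galois 1%AS {:F}%AS.
Variables (g : nat) (P0 : point F).
Hypothesis genus_F : genus F g.
Hypothesis ram_P0 : forall P, ramified P <-> P = P0.
Hypothesis tot_P0 : totally_ramified P0.

Lemma branch_exists : exists y, one_branch_point y P0.
Proof.
have [Q PQ] := tot_P0; have [y [cy Py]] := coordinate_pole PQ; exists y.
split=> //.
- by move=> a; exists (Q a); case: PQ => _ ->.
- by move=> P PP0 u cu; apply: unramified_pval => //; rewrite ram_P0.
- by move=> z; apply: genus_complete genus_F.
Qed.

Variables (y : ratfun k) (branch : one_branch_point y P0).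

Lemma integral_closureP Q e w : ramification_index P0 Q e ->
  integral_closure Q w <-> vge P0 0 w.
Proof.
move=> [e0 PQ]; split=> [[p [mon_p p_ge0 root_p]]|w_ge0].
  apply: integral_poly_vge0 root_p; first exact: monic_map.
  move=> i; rewrite coef_map /= /vge PQ mulr_ge0 ?orbT //; exact: p_ge0.
have /polyOver1P[p eqp] := minPolyOver 1%AS w.
exists p; split=> [|i|].
- by have := monic_minPoly 1%AS w; rewrite eqp map_monic.
- rewrite /valuation_ring; have [->|p0] := eqVneq p`_i 0;
  first by rewrite pval0.
  have := coef_minPoly1_vge0 gal_F i (P := P0) (b := w).
  rewrite eqp coef_map /= vgeE ?alg_eq0 // PQ pmulr_rge0 ?ltz_nat //; apply=> s.
  by rewrite /vge (pval0_conj ff_constE branch) gal_eq0.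
- by rewrite -eqp root_minPoly.
Qed.

Lemma complementary_moduleP Q e z : ramification_index P0 Q e ->
  complementary_module Q z <->
  forall w, vge P0 0 w -> vge P0 0 (Tr (z * w)).
Proof.
move=> ramQ; have [e0 PQ] := ramQ; split=> compl w.
  move/(integral_closureP _ ramQ)/compl => [a Qa ->].
  by rewrite /vge PQ mulr_ge0 ?orbT.
move/(integral_closureP _ ramQ)/compl; have [a ->] := tr_alg gal_F (z * w).
move=> a_ge0; exists a => //; rewrite /valuation_ring.
have [->|a0] := eqVneq a 0; first by rewrite pval0.
by move: a_ge0; rewrite vgeE ?alg_eq0 // PQ pmulr_rge0 ?ltz_nat.
Qed.

Lemma different_exponentP delta : different_exponent P0 delta ->
  forall z, (forall w, vge P0 0 w -> vge P0 0 (Tr (z * w))) <->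
    vge P0 (- delta%:Z) z.
Proof.
move=> [Q [e [ramQ [t [t0 gen Pt]]]]] z.
rewrite -(complementary_moduleP z ramQ) gen -Pt.
split=> [[w /(integral_closureP _ ramQ) w_ge0 ->]|z_ge].
  by rewrite vgeMl // subrr.
exists (t^-1 * z); last by rewrite mulVKf.
by apply/(integral_closureP _ ramQ);
  rewrite vgeMl ?invr_eq0 // pvalV sub0r opprK.
Qed.

End Branch.

End FunctionField.
(** * The genus and the symmetry of the Weierstrass semigroup *)

Lemma freeg_points (T : choiceType) (D : {freeg T / int}) :
  exists s1 s2 : seq T,
  (forall P, coeff P D = (count_mem P s1)%:Z - (count_mem P s2)%:Z) /\
  deg D = (size s1)%:Z - (size s2)%:Z.
Proof.
rewrite -(freeg_sumE D); elim: (dom D) => [|R r [s1 [s2 [IHc IHd]]]].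
  by exists [::], [::]; rewrite big_nil; split=> [P|]; rewrite ?coeff0 ?deg0.
rewrite big_cons; case: (coeff R D) => c.
  exists (nseq c R ++ s1), s2; split=> [P|].
    rewrite coeffD coeffU IHc count_cat count_nseq /=.
    by case: (R == P); rewrite ?mulr1 ?mulr0 ?mul1n ?mul0n; lia.
  by rewrite degD degU IHd size_cat size_nseq; lia.
exists s1, (nseq c.+1 R ++ s2); split=> [P|].
  rewrite coeffD coeffU IHc count_cat count_nseq /=.
  by case: (R == P); rewrite ?mulr1 ?mulr0 ?mul1n ?mul0n; lia.
by rewrite degD degU IHd size_cat size_nseq; lia.
Qed.

Section Genus.

Variables (k : closedFieldType) (F : splittingFieldType (ratfun k)).
Variables (y : ratfun k) (P0 : point F) (N : int).
Hypothesis branch : one_branch_point y P0.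
Hypothesis symmetry : forall m, pole_number P0 m <-> ~ pole_number P0 (N - m).
Implicit Types (D : divisor F) (f : F).

Local Notation gaps := (gaps_below P0 (absz (N + 1))).

Lemma RRdim_at_point (m : nat) :
  RRdim << m%:Z *g P0 >> (count (is_pole_number P0) (seq.iota 0 m.+1)).
Proof.
have [b [hb freeb span]] := basis_at_point (@ff_constE k F) branch m.
have eqD : at_point P0 m%:Z =1 (fun P => coeff P << m%:Z *g P0 >>).
  move=> P; rewrite coeffU /at_point [P0 == P]eq_sym.
  by case: (P == P0); rewrite ?mulr1 ?mulr0.
exists b; split=> // [i|f /RRspaceP Df]; last by apply: span => P; rewrite eqD.
by apply/RRspaceP => P; rewrite -eqD; apply: hb.
Qed.

(** The maximum defining the genus is attained by the divisors c P0 with c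
    large, by Riemann's inequality. *)
Lemma genus_eq_gaps g : genus F g -> g = size gaps.
Proof.
move=> [max_g [D [m [dimD eq_g]]]]; apply/eqP; rewrite eqn_leq; apply/andP;
  split.
  have [s1 [s2 [eqD eq_deg]]] := freeg_points D.
  have [n le_n [b [hb freeb]]] :=
    riemann_inequality (@ff_constE k F) branch symmetry s1 s2.
  have le_nm : (n <= m)%N.
    apply: const_free_RRdim dimD _ freeb => i.
    by apply/RRspaceP => P; rewrite eqD; apply: hb.
  have : (size s1 + 1 <= m + size gaps + size s2)%N.
    by apply: leq_trans le_n _; rewrite !leq_add2r.
  by move: eq_g; rewrite eq_deg; move: (size gaps) => gam; lia.
have := max_g _ _ (RRdim_at_point (absz (N + 1))); rewrite degU.
have := count_pole_numbers branch symmetry (leqnSn (absz (N + 1))).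
by move: (count _ _) (size gaps) => c gam; lia.
Qed.

End Genus.

Lemma gaps_symmetric (k : closedFieldType) (F : splittingFieldType (ratfun k))
    (y : ratfun k) (P0 : point F) (N : int) (g : nat) :
    one_branch_point y P0 ->
    (forall m, pole_number P0 m <-> ~ pole_number P0 (N - m)) ->
    genus F g -> (0 < g)%N ->
  [/\ N + 1 = 2 * g%:Z, biggest_gap (weierstrass_semigroup P0) (2 * g - 1)
    & symmetric_semigroup (weierstrass_semigroup P0) g].
Proof.
move=> branch symmetry genus_g g_gt0.
have eq_g := genus_eq_gaps branch symmetry genus_g.
have eqB := size_gaps branch symmetry; rewrite -eq_g in eqB.
have eqN := bound_eq branch symmetry.
set B := absz (N + 1) in eqB eqN eq_g.
have gapP (m : nat) : gap (weierstrass_semigroup P0) m <-> m \in gaps_below P0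
  B.
  rewrite mem_filter mem_iota add0n /gap (propext (weierstrassP m branch));
    split.
    move=> [m0 gap_m]; apply/andP; split; first exact/asboolPn.
    rewrite ltnNge; apply/negP.
    by move=> /(pole_number_large branch symmetry)/asboolP.
  move=> /andP[/asboolPn gap_m _]; split=> //; rewrite lt0n; apply/eqP => m0.
  by apply: gap_m; rewrite m0; apply: pole_number0.
have B_gt0 : (0 < B)%N by rewrite eqB muln_gt0.
have gaps_rcons : gaps_below P0 B = rcons (gaps_below P0 B.-1) B.-1.
  rewrite /gaps_below -{1}(prednK B_gt0) -addn1 iotaD cats1 filter_rcons /=.
  have := pole_number_rev branch symmetry B_gt0; rewrite subn1 -/B => ->.
  by have -> : is_pole_number P0 0 by apply/asboolP; apply: pole_number0.
have eq_last : (2 * g - 1)%N = B.-1 by rewrite eqB subn1.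
split; first by rewrite -eqN eqB PoszM.
- split=> [|m /gapP].
    by apply/gapP; rewrite eq_last gaps_rcons mem_rcons mem_head.
  rewrite mem_filter mem_iota eq_last add0n => /and3P[_ _ lt_mB].
  by rewrite -ltnS prednK.
exists (gaps_below P0 B); split=> //.
- by apply: (sorted_filter ltn_trans); apply: iota_ltn_sorted.
- by move=> m; rewrite gapP.
by rewrite eq_last eq_g gaps_rcons size_rcons /= nth_rcons ltnn eqxx.
Qed.

Theorem lemma43 (k : closedFieldType) (p n : nat) (hp : p \in [pchar k])
  (F : splittingFieldType (ratfun k))
  (hgal : galois 1%AS {:F}%AS)
  (hcyc : cyclic 'Gal({:F}%AS / 1%AS)%g)
  (hdeg : \dim {:F} = (p ^ n)%N)
  (g : nat) (hg : genus F g) (hg2 : (2 <= g)%N)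
  (P0 : point F)
  (hram : forall P : point F, ramified P <-> P = P0)
  (htot : totally_ramified P0)
  (delta : nat) (hdelta : different_exponent P0 delta) :
  let q := (p ^ n)%N in
  let Gamma0 := boseck0 q delta in
  let rho0 := boseck_rem0 q delta in
  (exists m : nat,
     [/\ biggest_gap (weierstrass_semigroup P0) m,
         m%:Z = (Gamma0%:Z - 2) * q%:Z + rho0%:Z + 1
       & m%:Z = delta%:Z - 2 * q%:Z + 1]) /\
  symmetric_semigroup (weierstrass_semigroup P0) g.
Proof.
move=> q Gamma0 rho0; have [y branch] := branch_exists hgal hg hram htot.
have different := different_exponentP hgal branch hdelta.
have sym := pole_number_symmetry (@ff_constE k F) branch different.
have [eq_g big_gap sym_g] := gaps_symmetric branch sym hg (ltnW hg2).
have eq_m : (2 * g - 1)%N%:Z = delta%:Z - 2 * q%:Z + 1.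
  by move: eq_g; rewrite hdeg -/q; lia.
split=> //; exists (2 * g - 1)%N; split=> //; rewrite eq_m.
have -> : delta%:Z = Gamma0%:Z * q%:Z + rho0%:Z.
  by rewrite -PoszM -PoszD -divn_eq.
by ring.
Qed.
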